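(* Let $m,s,n$ be positive integers with $n\ge3$, $n\ne4$, $s\ge2$, $ms\ge3$, and let $r\in\mathbb{Z}_n^*$ with $r^{ms}=1$ or $r^{ms}=-1$ in $\mathbb{Z}_n$. Likewise let $m',s',n'$ be positive integers with $n'\ge3$, $n'\ne4$, $s'\ge2$, $m's'\ge3$, and let $r'\in\mathbb{Z}_{n'}^*$ with $r'^{m's'}=1$ or $r'^{m's'}=-1$ in $\mathbb{Z}_{n'}$. If the graphs $\Gamma=\mathrm{CPM}(m,s,n;r)$ and $\Gamma'=\mathrm{CPM}(m',s',n';r')$ are both $2$-arc-transitive, then $\Gamma'\cong\Gamma$ if and only if $m'=m$, $s'=s=2$, $n'=n$, and $(r'r^{-1})^2=1$ or $(r'r^{-1})^2=-1$ in $\mathbb{Z}_n$.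
   Context: For positive integers $m,s,n$ with $n\ge 3$ and $r\in\mathbb{Z}_n^*$ with $r^{ms}=1$ or $r^{ms}=-1$ in $\mathbb{Z}_n$, let $\overline{\mathrm{CPM}}(m,s,n;r)$ be the simple undirected graph with vertices $\langle i;\mathbf v\rangle$, $i\in\mathbb{Z}_{ms}$, $\mathbf v=(v_0,\dots,v_{s-1})\in\mathbb{Z}_n^s$, where $\langle i;\mathbf v\rangle$ is adjacent to the two vertices $\langle i+1;\mathbf v\pm r^i\mathbf e_\ell\rangle$; here $\ell\in\{0,\dots,s-1\}$ is the residue of $i$ modulo $s$ and $\mathbf e_0,\dots,\mathbf e_{s-1}$ are the standard vectors of $\mathbb{Z}_n^s$ (well defined, as $r^i$ is determined up to sign). $\mathrm{CPM}(m,s,n;r)$ is the connected component containing $\langle 0;\mathbf 0\rangle$. A graph is $2$-arc-transitive if its automorphism group is transitive on the sequences $(v_0,v_1,v_2)$ of vertices with $v_0\sim v_1\sim v_2$ and $v_0\neq v_2$. *)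

(* Defs.v *)
From mathcomp Require Import all_boot all_order all_algebra all_fingroup.

Set Implicit Arguments.
Unset Strict Implicit.
Unset Printing Implicit Defensive.

Import GRing.Theory.
Local Open Scope ring_scope.

Record sgraph := SGraph {
  svertex :> finType;
  sedge : rel svertex;
  sedge_sym : symmetric sedge;
  sedge_irr : irreflexive sedge
}.

Definition isomorphic (G H : sgraph) : Prop :=
  exists2 f : G -> H, bijective f & {mono f : x y / sedge x y}.

Definition automorphism (G : sgraph) (g : {perm G}) : Prop :=
  {mono g : x y / sedge x y}.

Definition two_arc (G : sgraph) (a : G * G * G) : Prop :=
  [/\ sedge a.1.1 a.1.2, sedge a.1.2 a.2 & a.1.1 != a.2].

Definition two_arc_transitive (G : sgraph) : Prop :=
  forall a b : G * G * G, two_arc a -> two_arc b ->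
  exists2 g : {perm G}, automorphism g &
    (g a.1.1, g a.1.2, g a.2) = b.

Section Component.
Variables (G : sgraph) (x0 : G).

Definition component_vertex := {x : G | connect (@sedge G) x0 x}.

Definition component_edge : rel component_vertex :=
  fun x y => sedge (val x) (val y).

Fact component_edge_sym : symmetric component_edge.
Proof. by move=> x y; apply: sedge_sym. Qed.

Fact component_edge_irr : irreflexive component_edge.
Proof. by move=> x; apply: sedge_irr. Qed.

Definition component : sgraph :=
  SGraph component_edge_sym component_edge_irr.

End Component.

(* 'Z_k is the ring of integers modulo k only when 1 < k, so the graphs below
   are meaningful only for 1 < m * s and 1 < n. *)
Section CPM.
Variables (m s n : nat) (r : 'Z_n).

Definition cpm_vertex := ('Z_(m * s) * 'rV['Z_n]_s)%type.

(* The vector e_l, where l is the residue of i modulo s. *)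
Definition std_vec (i : nat) : 'rV['Z_n]_s :=
  \row_(l < s) (l == i %% s :> nat)%N%:R.

(* r ^+ i uses the representative 0 <= i < m * s of x.1; another choice
   changes r ^+ i at most by a sign, as r ^+ (m * s) is 1 or -1. *)
Definition cpm_arc : rel cpm_vertex := fun x y =>
  let i : nat := x.1 in
  (y.1 == x.1 + 1) &&
  ((y.2 == x.2 + r ^+ i *: std_vec i) || (y.2 == x.2 - r ^+ i *: std_vec i)).

Definition cpm_edge : rel cpm_vertex := fun x y => cpm_arc x y || cpm_arc y x.

Fact cpm_edge_sym : symmetric cpm_edge.
Proof. by move=> x y; rewrite /cpm_edge orbC. Qed.

Fact cpm_edge_irr : irreflexive cpm_edge.
Proof.
move=> x; rewrite /cpm_edge orbb /cpm_arc.
by rewrite -[X in X == _]addr0 (inj_eq (addrI _)) eq_sym oner_eq0.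
Qed.

Definition CPMbar : sgraph := SGraph cpm_edge_sym cpm_edge_irr.

Definition CPM : sgraph := component ((0, 0) : CPMbar).

End CPM.

Arguments CPM : clear implicits.

(* Transports x to the residue modulo n of its representative; for n' = n this
   is the identity. *)
Definition Zn_cast (n' n : nat) (x : 'Z_n') : 'Z_n := (x : nat)%:R.
Arguments Zn_cast {n'} n x.

(* Main.v *)
(* Write q = r^2. Closed nonbacktracking walks are determined by words in the
   steps "up" and "down" with signs, and such a word closes up exactly when a
   few integer polynomials in r^s vanish in Z_n. In a 2-arc-transitive graph the
   turning 2-arc up-down and the straight 2-arc up-up must have the same number
   of extensions to 3-arcs lying on a given number of octagons (or hexagons).

   For s >= 3 the octagons rule this out. For s = 2 and 2q different from 2 and
   -2 they leave only m = 4 and a degenerate vanishing sum 1 +- q +- q^2 +- q^3;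
   there every 2-arc has a unique extension off all octagons, and the zigzags
   obtained by iterating it close up after different lengths for the two kinds
   of 2-arcs. So s = 2 and 2q = 2 or 2q = -2: hexagons up-up-up-down-down-down
   exist, and for n different from 3 and 6 every 2-arc has a unique extension
   off the hexagons. The turning zigzags close up after k steps exactly when 2
   and n divide k, while straight zigzags of length n exclude q = 1 and q = -1
   when n is even. Hence n is odd and q = 1 or -1, or 4 divides n, m is even and
   q = n/2 + 1 or n/2 - 1. The zigzags recover n (with n = 3 detected by all
   extensions of a turning 2-arc lying on hexagons), n determines q up to sign,
   and the order 2m |2 Z_n^2| of the component recovers m. Conversely, scaling
   the second coordinate by r'/r is an isomorphism. *)
Require Import Defs.
From mathcomp Require Import all_boot all_order all_algebra.
From mathcomp Require Import zify ring.

Set Implicit Arguments.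
Unset Strict Implicit.
Unset Printing Implicit Defensive.

Import GRing.Theory.
Local Open Scope ring_scope.

(** * Closed walks and zigzags *)

(** Every graph with s >= 2 contains the octagon up-down-down-up-up-down-down-up, the commutator of
    the two turns up-down and down-up at one vertex, which shift two different directions by twice a
    step vector. It covers both extensions of up-down by a down step, but only the down extension of
    up-up. So transitivity forces further octagons through up-up-up, and these can only come from
    coincidences in [Z_n] or from wrapping around the layers. The obstacle is that n and r are
    variables, so closed walks cannot simply be counted. Instead, words in a fixed window of layers
    are enumerated by computation with integer coefficients, and the counts are bounded from both
    sides: from below by the words whose coordinate polynomials are known to vanish, from above by
    discarding the words with a polynomial on a list of known non-zeros. The arithmetic of r enters
    only through these lists, and each case has to justify the entries of its lists. *)

Section Walks.
Variable G : sgraph.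

(* Nonbacktracking walks of k steps from the dart (a, b) to the dart (x, y); so
   nb_walks L z w x y counts the closed nonbacktracking walks of length L + 2
   that start with the 3-arc (x, y, z, w). *)
Fixpoint nb_walks (k : nat) (a b x y : G) : nat :=
  if k is k'.+1 then (\sum_(c | sedge b c && (c != a)) nb_walks k' b c x y)%N
  else ((a == x) && (b == y) : nat).

Definition ext_count (Q : pred nat) (L : nat) (x y z : G) : nat :=
  (\sum_(w | sedge z w && (w != y)) (Q (nb_walks L z w x y) : nat))%N.

(* A zigzag prolongs a 2-arc by a vertex that completes it to a 3-arc lying on
   no closed nonbacktracking walk of length L + 2. *)
Fixpoint zigzag (L k : nat) (x y z x' y' z' : G) : bool :=
  if k is k'.+1 then
    [exists w, [&& sedge z w, w != y, nb_walks L z w x y == 0%N &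
                zigzag L k' y z w x' y' z']]
  else [&& x == x', y == y' & z == z'].

Lemma zigzagE L (c : nat -> G) k x y z :
  (forall i w, [&& sedge (c i.+2) w, w != c i.+1 &
                nb_walks L (c i.+2) w (c i) (c i.+1) == 0%N] = (w == c i.+3)) ->
  zigzag L k (c 0%N) (c 1%N) (c 2%N) x y z =
  [&& c k == x, c k.+1 == y & c k.+2 == z].
Proof.
elim: k c => [//|k IHk] c Hc /=.
rewrite -(IHk (fun i => c i.+1)); last by move=> i w; apply: Hc.
apply/existsP/idP => [[w]|H].
  by move=> /and4P[h1 h2 h3]; move: (Hc 0%N w); rewrite h1 h2 h3 => /esym/eqP->.
by exists (c 3%N); move: (Hc 0%N (c 3%N)); rewrite eqxx => /and3P[-> -> ->].
Qed.

End Walks.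

(* This covers both isomorphisms and the inclusion of a connected component. *)
Section LocalIsomorphism.
Variables (G H : sgraph) (f : G -> H).
Hypothesis f_inj : injective f.
Hypothesis f_mono : {mono f : x y / sedge x y}.
Hypothesis f_nbr : forall x y, sedge (f x) y -> exists z, y = f z.

Lemma local_iso_sum (F : H -> nat) (a b : G) :
  (\sum_(c | sedge (f b) c && (c != f a)) F c =
   \sum_(c | sedge b c && (c != a)) F (f c))%N.
Proof.
rewrite -(big_imset F (h := f)
  (A := [pred c | sedge b c && (c != a)])) /=; last first.
  by move=> x y _ _; apply: f_inj.
apply: eq_bigl => y; apply/idP/imsetP => [/andP[e n]|[x + ->]].
  have [z zE] := f_nbr e; exists z => //.
  by rewrite inE -f_mono -(inj_eq f_inj) -zE e n.
by rewrite inE f_mono (inj_eq f_inj).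
Qed.

Lemma local_iso_nb_walks k a b x y : nb_walks k (f a) (f b) (f x) (f y) = nb_walks k a b x y.
Proof.
elim: k a b => [|k IHk] a b /=; first by rewrite !(inj_eq f_inj).
by rewrite local_iso_sum; apply: eq_bigr => c _; rewrite IHk.
Qed.

Lemma local_iso_ext_count Q L x y z :
  ext_count Q L (f x) (f y) (f z) = ext_count Q L x y z.
Proof.
rewrite /ext_count local_iso_sum.
by apply: eq_bigr => w _; rewrite local_iso_nb_walks.
Qed.

Lemma local_iso_zigzag L k x y z x' y' z' :
  zigzag L k (f x) (f y) (f z) (f x') (f y') (f z') =
  zigzag L k x y z x' y' z'.
Proof.
elim: k x y z => [|k IHk] x y z /=; first by rewrite !(inj_eq f_inj).
apply/existsP/existsP => [[w /and4P[e n c h]]|[w /and4P[e n c h]]].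
  have [u uE] := f_nbr e; subst w; exists u.
  by rewrite -f_mono e -(inj_eq f_inj) n -local_iso_nb_walks c -IHk h.
exists (f w).
by rewrite f_mono e (inj_eq f_inj) n local_iso_nb_walks c IHk h.
Qed.

End LocalIsomorphism.

Section ComponentInvariants.
Variables (G : sgraph) (x0 : G).
Let C := component x0.
Definition component_val (x : C) : G := val x.

Lemma component_val_inj : injective component_val.
Proof. exact: val_inj. Qed.

Lemma component_val_mono : {mono component_val : x y / sedge x y}.
Proof. by []. Qed.

Lemma component_nbr (x : C) (y : G) :
  sedge (component_val x) y -> exists z : C, y = component_val z.
Proof.
move=> e; have h : connect (@sedge G) x0 y.
  by apply: connect_trans (valP x) _; apply: connect1.
by exists (Sub y h); rewrite /component_val SubK.
Qed.

Lemma component_two_arc (x y z : G) :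
  connect (@sedge G) x0 x -> two_arc (x, y, z) ->
  exists x' y' z' : C, [/\ component_val x' = x, component_val y' = y,
    component_val z' = z & two_arc (x', y', z')].
Proof.
move=> cx [/= e1 e2 n].
have [x' xE] : exists x', x = component_val x'.
  by exists (Sub x cx); rewrite /component_val SubK.
subst x; have [y' yE] := component_nbr e1; subst y.
have [z' zE] := component_nbr e2; subst z.
by exists x', y', z'; split.
Qed.

End ComponentInvariants.

Lemma iso_nbr (G H : sgraph) (f : G -> H) :
  bijective f -> forall x y, sedge (f x) y -> exists z, y = f z.
Proof. by case=> g fK gK x y _; exists (g y); rewrite gK. Qed.

Section TwoArcTransitive.
Variables (G : sgraph) (x0 : G).
Hypothesis G_2at : two_arc_transitive (component x0).
Variables a b : G * G * G.
Hypothesis a_arc : two_arc a.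
Hypothesis b_arc : two_arc b.
Hypothesis a_conn : connect (@sedge G) x0 a.1.1.
Hypothesis b_conn : connect (@sedge G) x0 b.1.1.

(** A component is closed under neighbours, so walks from its vertices are the same inside it and in
    the whole graph. The invariants can therefore be computed in the ambient graph, where
    coordinates are available. *)
Lemma two_arc_transitive_ext_count Q L :
  ext_count Q L a.1.1 a.1.2 a.2 = ext_count Q L b.1.1 b.1.2 b.2.
Proof.
move: a b a_arc b_arc a_conn b_conn => [[x y] z] [[x' y'] z'] /= Ha Hb ca cb.
have [u [v [w [<- <- <- uvw]]]] := component_two_arc ca Ha.
have [u' [v' [w' [<- <- <- uvw']]]] := component_two_arc cb Hb.
have [g g_aut [<- <- <-]] := G_2at uvw uvw'.
rewrite !(local_iso_ext_count (@component_val_inj _ _)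
  (@component_val_mono _ _) (@component_nbr _ _)).
apply/esym/(local_iso_ext_count (@perm.perm_inj _ _) g_aut).
exact/iso_nbr/injF_bij/perm.perm_inj.
Qed.

Lemma two_arc_transitive_zigzag L k :
  zigzag L k a.1.1 a.1.2 a.2 a.1.1 a.1.2 a.2 =
  zigzag L k b.1.1 b.1.2 b.2 b.1.1 b.1.2 b.2.
Proof.
move: a b a_arc b_arc a_conn b_conn => [[x y] z] [[x' y'] z'] /= Ha Hb ca cb.
have [u [v [w [<- <- <- uvw]]]] := component_two_arc ca Ha.
have [u' [v' [w' [<- <- <- uvw']]]] := component_two_arc cb Hb.
have [g g_aut [<- <- <-]] := G_2at uvw uvw'.
rewrite !(local_iso_zigzag (@component_val_inj _ _)
  (@component_val_mono _ _) (@component_nbr _ _)).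
apply/esym/(local_iso_zigzag (@perm.perm_inj _ _) g_aut).
exact/iso_nbr/injF_bij/perm.perm_inj.
Qed.

End TwoArcTransitive.

Section Isomorphic.
Variables (G H : sgraph) (x0 : G) (y0 : H).
Hypothesis GH : isomorphic (component x0) (component y0).
Hypothesis H_2at : two_arc_transitive (component y0).
Variables (a : G * G * G) (b : H * H * H).
Hypothesis a_arc : two_arc a.
Hypothesis b_arc : two_arc b.
Hypothesis a_conn : connect (@sedge G) x0 a.1.1.
Hypothesis b_conn : connect (@sedge H) y0 b.1.1.

(** The isomorphism carries [a] to some 2-arc that need not be [b]; the transitivity of the target
    then equates the invariants of this image with those of [b]. *)
Lemma isomorphic_image :
  exists x y z (f : component x0 -> component y0),
  [/\ bijective f, {mono f : x y / sedge x y},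
      a = (component_val x, component_val y, component_val z),
      two_arc (component_val (f x), component_val (f y), component_val (f z)) &
      connect (@sedge H) y0 (component_val (f x))].
Proof.
have [f f_bij f_mono] := GH.
move: a a_arc a_conn => [[x y] z] /= Ha ca.
have [u [v [w [<- <- <- uvw]]]] := component_two_arc ca Ha.
exists u, v, w, f; split=> //; last exact: (valP (f u)).
case: uvw => /= e1 e2 n; split; rewrite /= ?component_val_mono ?f_mono //.
by rewrite (inj_eq (@component_val_inj _ _)) (inj_eq (bij_inj f_bij)).
Qed.

Lemma isomorphic_ext_count Q L :
  ext_count Q L a.1.1 a.1.2 a.2 = ext_count Q L b.1.1 b.1.2 b.2.
Proof.
have [x [y [z [f [f_bij f_mono -> arc conn]]]]] := isomorphic_image.
rewrite -(two_arc_transitive_ext_count H_2at arc b_arc conn b_conn) /=.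
rewrite !(local_iso_ext_count (@component_val_inj _ _)
  (@component_val_mono _ _) (@component_nbr _ _)).
by rewrite (local_iso_ext_count (bij_inj f_bij) f_mono (iso_nbr f_bij)).
Qed.

Lemma isomorphic_zigzag L k :
  zigzag L k a.1.1 a.1.2 a.2 a.1.1 a.1.2 a.2 =
  zigzag L k b.1.1 b.1.2 b.2 b.1.1 b.1.2 b.2.
Proof.
have [x [y [z [f [f_bij f_mono -> arc conn]]]]] := isomorphic_image.
rewrite -(two_arc_transitive_zigzag H_2at arc b_arc conn b_conn) /=.
rewrite !(local_iso_zigzag (@component_val_inj _ _)
  (@component_val_mono _ _) (@component_nbr _ _)).
by rewrite (local_iso_zigzag (bij_inj f_bij) f_mono (iso_nbr f_bij)).
Qed.

End Isomorphic.

Lemma Zn_nat_eq0 n k : (1 < n)%N -> (k%:R == 0 :> 'Z_n) = (n %| k)%N.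
Proof. by move=> n_gt1; rewrite -(inj_eq val_inj) /= val_Zp_nat. Qed.

Lemma Zn_nat_eq n a b : (1 < n)%N ->
  (a%:R == b%:R :> 'Z_n) = (a == b %[mod n])%N.
Proof. by move=> n_gt1; rewrite -(inj_eq val_inj) /= !val_Zp_nat. Qed.

Lemma Zn_natE n (x : 'Z_n) : (1 < n)%N -> x = (x : nat)%:R.
Proof.
move=> n_gt1; apply/val_inj; rewrite /= val_Zp_nat // modn_small //.
by rewrite -[X in (_ < X)%N](Zp_cast n_gt1).
Qed.

Lemma signed_eqC (V : zmodType) (u v w : V) :
  ((v == w + u) || (v == w - u)) = ((w == v + u) || (w == v - u)).
Proof.
rewrite ![v == _]eq_sym -[w + u == v]subr_eq0 -[w - u == v]subr_eq0.
rewrite -[w == v + u]subr_eq0 -[w == v - u]subr_eq0 !opprD !opprK !addrA.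
by rewrite orbC ![w - v + _]addrAC.
Qed.

(** * Lifting vertices and symbolic walks *)

(* The letter (true, b) goes one layer up from layer j, adding (-1)^b r^j e_j;
   (false, b) goes one layer down to layer j - 1, adding (-1)^b r^(j-1) e_(j-1). *)
Notation letter := (bool * bool)%type (only parsing).
Definition letters : seq letter :=
  [:: (true, false); (true, true); (false, false); (false, true)].
Definition letter_inv (l : letter) : letter := (~~ l.1, ~~ l.2).

Section Lift.
Variables (m s n : nat) (r : 'Z_n).
Hypothesis n_ge3 : (3 <= n)%N.
Hypothesis ms_ge3 : (3 <= m * s)%N.
Hypothesis r_unit : r \is a GRing.unit.
Hypothesis r_ms : r ^+ (m * s) = 1 \/ r ^+ (m * s) = -1.

Let n_gt1 : (1 < n)%N. Proof. by apply: leq_trans n_ge3. Qed.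
Let ms_gt1 : (1 < m * s)%N. Proof. by apply: leq_trans ms_ge3. Qed.
Let s_gt0 : (0 < s)%N. Proof. by case: s ms_ge3 => //; rewrite muln0. Qed.

Definition gen (j : nat) : 'rV['Z_n]_s := r ^+ j *: std_vec s n j.

Definition lifted := (nat * 'rV['Z_n]_s)%type.

(* Layers are lifted to natural numbers; using r ^+ j for an arbitrary lift j
   is harmless, since both signs of it occur among the steps. *)
Definition cov (S : lifted) : CPMbar m s r := (S.1%:R, S.2).

Definition step (S : lifted) (l : letter) : lifted :=
  if l.1 then (S.1.+1, S.2 + (-1) ^+ l.2 *: gen S.1)
  else (S.1.-1, S.2 + (-1) ^+ l.2 *: gen S.1.-1).

(** Dropping multiples of [m * s] from the exponent divides by a power of [r ^+ (m * s)], which is 1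
    or -1, and keeps the direction because s divides [m * s]. *)
Lemma gen_mod j : exists b : bool,
  r ^+ (j %% (m * s)) *: std_vec s n (j %% (m * s)) = (-1) ^+ b *: gen j.
Proof.
rewrite /gen /std_vec modn_dvdm ?dvdn_mull //.
have [b bE] : exists b : bool, r ^+ (j %/ (m * s) * (m * s)) = (-1) ^+ b.
  rewrite mulnC exprM; case: r_ms => ->; first by exists false; rewrite expr1n.
  by exists (odd (j %/ (m * s))); rewrite signr_odd.
exists b.
have -> : r ^+ j = r ^+ (j %/ (m * s) * (m * s)) * r ^+ (j %% (m * s)).
  by rewrite -exprD -divn_eq.
rewrite bE.
by rewrite !scalerA mulrA -signr_addb addbb mul1r.
Qed.

Lemma signed_eq (b : bool) (u v w : 'rV['Z_n]_s) :
  ((w == v + (-1) ^+ b *: u) || (w == v - (-1) ^+ b *: u)) =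
  ((w == v + u) || (w == v - u)).
Proof. by case: b; rewrite ?expr1 ?expr0 ?scaleN1r ?scale1r ?opprK // orbC. Qed.

Lemma arc_cov (S : lifted) w : cpm_arc r (cov S) w =
  (w == cov (step S (true, false))) || (w == cov (step S (true, true))).
Proof.
case: w => i w; rewrite /cpm_arc /cov /= val_Zp_nat //.
have [b ->] := gen_mod S.1.
rewrite signed_eq scale1r scaleN1r !xpair_eqE -natr1.
by rewrite andb_orr.
Qed.

Lemma cov_arc (S : lifted) w : (0 < S.1)%N -> cpm_arc r w (cov S) =
  (w == cov (step S (false, false))) || (w == cov (step S (false, true))).
Proof.
case: S => [[//|j] v] _; case: w => i w.
have stepE b : cov (step (j.+1, v) (false, b)) = (j%:R, v + (-1) ^+ b *: gen j) by [].
rewrite !stepE scale1r scaleN1r !xpair_eqE -andb_orr.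
rewrite /cpm_arc /cov ![(_, _).1]/= ![(_, _).2]/=.
rewrite -natr1 (inj_eq (addIr _)) eq_sym.
case: (i =P j%:R) => [->|_]; last by rewrite !andFb.
rewrite val_Zp_nat; last exact: ms_gt1.
by have [b ->] := gen_mod j; rewrite signed_eq signed_eqC.
Qed.

Lemma cov_nbr (S : lifted) w : (0 < S.1)%N ->
  sedge (cov S) w = (w \in [seq cov (step S l) | l <- letters]).
Proof.
move=> S_gt0; rewrite /sedge /= /cpm_edge arc_cov cov_arc // !inE.
by rewrite -!orbA.
Qed.

Lemma gen_neq j : - gen j != gen j.
Proof.
apply/negP => /eqP/rowP/(_ (Ordinal (ltn_pmod j s_gt0))).
rewrite !mxE /= eqxx mulr1 => /eqP; rewrite -subr_eq0 -opprD oppr_eq0 -mulr2n -mulr_natl.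
rewrite (mulIr_eq0 _ (mulIr (unitrX j r_unit))).
by rewrite Zn_nat_eq0 // => /(dvdn_leq (isT : (0 < 2)%N)); rewrite leqNgt n_ge3.
Qed.

Lemma cov_eq (S T : lifted) :
  (cov S == cov T) = (S.1 == T.1 %[mod m * s]) && (S.2 == T.2).
Proof. by rewrite /cov xpair_eqE Zn_nat_eq. Qed.

(** Up and down neighbours lie two layers apart, so [m * s >= 3] separates them; the two signs
    differ by twice a unit multiple of a standard vector, nonzero as [n >= 3]. *)
Lemma cov_step_inj (S : lifted) : (0 < S.1)%N ->
  injective (fun l => cov (step S l)).
Proof.
case: S => [[//|j] v] _.
have jj : (j.+2 == j %[mod m * s]) = false.
  have -> : (j.+2 == j %[mod m * s]) = (2 + j == 0 + j %[mod m * s]) by [].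
  rewrite eqn_modDr mod0n.
  by apply/negP => /(dvdn_leq (isT : (0 < 2)%N)); rewrite leqNgt ms_ge3.
move=> [a b] [c d] /eqP; rewrite cov_eq => /andP[e1 e2].
have ac : a = c.
  move: e1; case: a {e2}; case: c; rewrite /step /= ?jj //.
  by rewrite eq_sym jj.
rewrite -ac in e2 *; congr pair; move: e2; rewrite /step.
by case: a {e1 ac} => /=; rewrite (inj_eq (addrI _)); case: b; case: d => //;
  rewrite scale1r scaleN1r ?(eq_sym (gen _)) (negPf (gen_neq _)).
Qed.

Lemma step_inv (S : lifted) l : (0 < S.1)%N -> step (step S l) (letter_inv l) = S.
Proof.
case: S l => [[//|j] v] [[] b] _; rewrite /step /= -addrA -scalerDl;
  by case: b; rewrite /= ?addrN ?addNr scale0r addr0.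
Qed.

Lemma sum_nbr (S : lifted) l (F : CPMbar m s r -> nat) : (1 < S.1)%N ->
  (\sum_(c | sedge (cov (step S l)) c && (c != cov S)) F c =
   \sum_(l' <- letters | l' != letter_inv l) F (cov (step (step S l) l')))%N.
Proof.
move=> S_gt1; have T_gt0 : (0 < (step S l).1)%N.
  by rewrite /step; case: l.1 => //=; case: (S.1) S_gt1 => [|[]].
have S_gt0 : (0 < S.1)%N by apply: leq_trans S_gt1.
set T := step S l in T_gt0 *.
(* [S] is the neighbour of [T] along the inverse letter, so avoiding [cov S] forbids exactly one
   letter. *)
rewrite -{1}[S](step_inv l S_gt0) -/T.
transitivity (\sum_(c <- [seq cov (step T l') | l' <- letters]
  | c != cov (step T (letter_inv l))) F c)%N; last first.
  rewrite big_map; apply: eq_bigl => l'.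
  by rewrite (inj_eq (cov_step_inj T_gt0)).
rewrite -[RHS]big_filter big_uniq; last first.
  by apply: filter_uniq; rewrite (map_inj_uniq (cov_step_inj T_gt0)).
by apply: eq_bigl => c; rewrite mem_filter -cov_nbr // andbC.
Qed.

Definition closed_walks (L : nat) (S : lifted) (l1 l2 l3 : letter) : nat :=
  let S1 := step S l1 in let S2 := step S1 l2 in
  nb_walks L (cov S2) (cov (step S2 l3)) (cov S) (cov S1).

Lemma ext_count_cov Q L S l1 l2 : (2 < S.1)%N ->
  ext_count Q L (cov S) (cov (step S l1)) (cov (step (step S l1) l2)) =
  (\sum_(l3 <- letters | l3 != letter_inv l2) (Q (closed_walks L S l1 l2 l3) : nat))%N.
Proof.
move=> S_gt; rewrite /ext_count sum_nbr //.
by rewrite /step; case: l1.1 => //=; case: (S.1) S_gt => [|[]].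
Qed.

Lemma two_arc_cov S l1 l2 : (1 < S.1)%N -> l2 != letter_inv l1 ->
  two_arc (cov S, cov (step S l1), cov (step (step S l1) l2)).
Proof.
move=> S_gt n12.
have T_gt0 : (0 < (step S l1).1)%N.
  by rewrite /step; case: l1.1 => //=; case: (S.1) S_gt => [|[]].
have mem (l : letter) : l \in letters by case: l => [[] []].
have S_gt0 : (0 < S.1)%N by apply: ltn_trans S_gt.
split; rewrite [_.1]/= [_.2]/=.
- by rewrite (cov_nbr _ S_gt0); apply/mapP; exists l1.
- by rewrite (cov_nbr _ T_gt0); apply/mapP; exists l2.
- rewrite -{1}[S](step_inv l1) //.
  by rewrite (inj_eq (cov_step_inj T_gt0)) eq_sym.
Qed.

End Lift.

(* The symbolic state (p, c) stands for layer J + p and for the vector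
   v + \sum_i c_i r^(J+i) e_(J+i). Walks of length at most 8 starting at p = 9
   stay inside the window of the 20 layers J, ..., J + 19. *)
Definition sym_state := (nat * seq int)%type.
Definition bump_coef (c : seq int) (p : nat) (b : bool) : seq int :=
  set_nth 0 c p (c`_p + (-1) ^+ b).
Definition sym_step (t : sym_state) (l : letter) : sym_state :=
  if l.1 then (t.1.+1, bump_coef t.2 t.1 l.2)
  else (t.1.-1, bump_coef t.2 t.1.-1 l.2).
Lemma sym_step_fst t l : (t.1.-1 <= (sym_step t l).1 <= t.1.+1)%N.
Proof. by rewrite /sym_step; case: l.1 => /=; lia. Qed.

Definition diff_coef (c d : seq int) : seq int :=
  [seq c`_i - d`_i | i <- iota 0 20].
Definition dist (p q : nat) : nat := ((p - q) + (q - p))%N.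

Definition letters_after (l : letter) : seq letter :=
  [seq l' <- letters | l' != letter_inv l].
Arguments letters_after : simpl never.

Fixpoint count_words (test : sym_state -> letter -> bool) (k : nat) (t : sym_state)
    (l : letter) : nat :=
  if k is k'.+1 then
    sumn [seq count_words test k' (sym_step t l) l' | l' <- letters_after l]
  else test t l.

Definition base : sym_state := (9%N, [::]).

Definition shut (zl : pred nat) (zv : pred (seq int)) (t u : sym_state) : bool :=
  zl (dist t.1 u.1) && zv (diff_coef t.2 u.2).
Definition apart (nl : pred nat) (nv : pred (seq int)) (t u : sym_state) : bool :=
  nl (dist t.1 u.1) || nv (diff_coef t.2 u.2).

(* zl and zv certify that a layer shift and a vector vanish, nl and nv that they
   do not; a word that is certified neither way is possible but not sure. *)
Definition sure_words (zl : pred nat) (zv : pred (seq int)) L l1 l2 l3 : nat :=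
  count_words (fun t l => shut zl zv t base && shut zl zv (sym_step t l) (sym_step base l1))
    L (sym_step (sym_step base l1) l2) l3.
Definition possible_words (nl : pred nat) (nv : pred (seq int)) L l1 l2 l3 : nat :=
  count_words (fun t l => ~~ (apart nl nv t base || apart nl nv (sym_step t l) (sym_step base l1)))
    L (sym_step (sym_step base l1) l2) l3.

Section Symbolic.
Variables (m s n : nat) (r : 'Z_n).
Hypothesis n_ge3 : (3 <= n)%N.
Hypothesis ms_ge3 : (3 <= m * s)%N.
Hypothesis r_unit : r \is a GRing.unit.
Hypothesis r_ms : r ^+ (m * s) = 1 \/ r ^+ (m * s) = -1.
Let ms_gt1 : (1 < m * s)%N. Proof. by apply: leq_trans ms_ge3. Qed.

Local Notation cov := (@cov m s n r).
Local Notation step := (@step s n r).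

Definition vec (J : nat) (c : seq int) : 'rV['Z_n]_s :=
  \sum_(i < 20) (c`_i)%:~R *: gen s r (J + i).
Definition realize (J : nat) (v : 'rV['Z_n]_s) (t : sym_state) : lifted s n :=
  ((J + t.1)%N, v + vec J t.2).

Lemma vec_bump J c p b : (p < 20)%N ->
  vec J (bump_coef c p b) = vec J c + (-1) ^+ b *: gen s r (J + p).
Proof.
move=> p_lt; rewrite /vec (bigD1 (Ordinal p_lt)) //= [in RHS](bigD1 (Ordinal p_lt)) //=.
rewrite nth_set_nth /= eqxx rmorphD /= scalerDl rmorphXn rmorphN1.
rewrite -!addrA; congr (_ + _); rewrite addrC; congr (_ + _).
apply: eq_bigr => i /negPf ne; rewrite nth_set_nth /=.
by rewrite -[(i == p :> nat)]/(i == Ordinal p_lt) ne.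
Qed.

Lemma realize_step J v t l : (0 < t.1)%N -> (t.1 < 20)%N ->
  step (realize J v t) l = realize J v (sym_step t l).
Proof.
case: t => [p c]; rewrite [_.1]/= => p_gt0 p_lt.
case: l => [[] b]; rewrite /step /realize /sym_step.
  by rewrite [_.1]/= [_.2]/= vec_bump // addrA addnS.
rewrite ![_.1]/= ![_.2]/= vec_bump ?addrA; last by apply: leq_ltn_trans p_lt; apply: leq_pred.
rewrite -!subn1 addnBA; last exact: p_gt0.
exact: erefl.
Qed.

Lemma vec_diff J c d : vec J (diff_coef c d) = vec J c - vec J d.
Proof.
rewrite /vec -sumrB; apply: eq_bigr => i _.
by rewrite (nth_map 0%N) ?size_iota // nth_iota // rmorphB scalerBl.
Qed.

Lemma eqn_mod_dist a b d :
  (a == b %[mod d]) = (d %| dist a b)%N.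
Proof.
rewrite /dist; case/orP: (leq_total a b) => ab.
  by rewrite eq_sym eqn_mod_dvd // (eqP ab) add0n.
by rewrite eqn_mod_dvd // (eqP ab) addn0.
Qed.

Lemma realize_cov_eq J v t u : (cov (realize J v t) == cov (realize J v u)) =
  ((m * s) %| dist t.1 u.1)%N && (vec J (diff_coef t.2 u.2) == 0).
Proof.
rewrite cov_eq // /realize /= eqn_modDl eqn_mod_dist.
by rewrite (inj_eq (addrI _)) vec_diff subr_eq0.
Qed.

Section Bounds.
Variables (zl nl : pred nat) (zv nv : pred (seq int)).
Hypothesis zlP : forall d, zl d -> (m * s %| d)%N.
Hypothesis nlP : forall d, nl d -> ~~ (m * s %| d)%N.
Hypothesis zvP : forall J c, zv c -> vec J c = 0.
Hypothesis nvP : forall J c, nv c -> vec J c != 0.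

Lemma shut_cov J v t u : shut zl zv t u ->
  cov (realize J v t) = cov (realize J v u).
Proof.
by case/andP=> /zlP h /(@zvP J) e; apply/eqP; rewrite realize_cov_eq h e eqxx.
Qed.

Lemma apart_cov J v t u : apart nl nv t u ->
  cov (realize J v t) != cov (realize J v u).
Proof.
by rewrite realize_cov_eq => /orP[/nlP/negPf->//|/(@nvP J)/negPf->]; rewrite andbF.
Qed.

Lemma nb_walks_words J v k t l x y : (k < t.1)%N -> (t.1 + k < 20)%N ->
  nb_walks k (cov (realize J v t)) (cov (step (realize J v t) l)) x y =
  count_words (fun t l => (cov (realize J v t) == x) &&
                          (cov (realize J v (sym_step t l)) == y)) k t l.
Proof.
elim: k t l => [|k IHk] t l kt tk.
  by rewrite addn0 in tk; rewrite /= realize_step.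
have t_gt0 : (0 < t.1)%N by apply: leq_ltn_trans kt.
have t_lt : (t.1 < 20)%N by apply: leq_ltn_trans (leq_addr _ _) tk.
rewrite /= sum_nbr //; last by rewrite /realize /=; lia.
rewrite sumnE big_map big_filter /=; apply: eq_bigr => l' _.
rewrite realize_step // IHk //; rewrite /sym_step; case: l.1 => /=; lia.
Qed.

Lemma leq_count_words (test test' : sym_state -> letter -> bool) k t l :
  (forall t l, test t l -> test' t l) ->
  (count_words test k t l <= count_words test' k t l)%N.
Proof.
move=> sub; elim: k t l => [|k IHk] t l /=.
  by case: (boolP (test t l)) => [/sub->|].
by rewrite !sumnE !big_map; apply: leq_sum.
Qed.

(** The closed walks correspond to the words whose final dart equals the initial one; every word
    counted as sure is of this kind, and every word of this kind is counted as possible. *)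
Lemma closed_walks_bounds L (S : lifted s n) l1 l2 l3 : (L <= 6)%N -> (9 <= S.1)%N ->
  (sure_words zl zv L l1 l2 l3 <= closed_walks m r L S l1 l2 l3 <= possible_words nl nv L l1 l2 l3)%N.
Proof.
move=> L_le S_ge; pose J := (S.1 - 9)%N.
have [v SE] : exists v, S = realize J v base.
  exists S.2; rewrite /realize /vec big1 ?addr0 ?subnK //; first by case: (S).
  by move=> i _; rewrite nth_nil scale0r.
clearbody J; subst S.
have p1 : (8 <= (sym_step base l1).1 <= 10)%N by rewrite /sym_step; case: l1.1.
have p2 : (7 <= (sym_step (sym_step base l1) l2).1 <= 11)%N.
  by have := sym_step_fst (sym_step base l1) l2; lia.
rewrite /closed_walks realize_step // realize_step; try lia.
rewrite nb_walks_words; try lia.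
rewrite /sure_words /possible_words; apply/andP; split; apply: leq_count_words => t l.
  by case/andP=> /shut_cov-> /shut_cov->; rewrite !eqxx.
case/andP=> /eqP h1 /eqP h2; apply/negP => /orP[] /apart_cov-/(_ J v).
  by rewrite h1 eqxx.
by rewrite h2 eqxx.
Qed.

End Bounds.
End Symbolic.

(** * Coordinates of displacements as polynomials in [r ^+ s] *)

Fixpoint peval (R : pzRingType) (t : R) (P : seq int) : R :=
  if P is c :: P' then c%:~R + t * peval t P' else 0.

(* Every s-th coefficient: the coordinate of index (J + l) %% s of the vector is
   r ^+ (J + l) times the value at r ^+ s of the polynomial so obtained. *)
Definition coef_class (s l : nat) (c : seq int) : seq int :=
  [seq c`_i | i <- iota 0 20 & (i %% s == l)%N].

Fixpoint ltrim (P : seq int) : seq int :=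
  if P is c :: P' then if c == 0 then ltrim P' else P else [::].
Definition trim (P : seq int) : seq int := rev (ltrim (rev (ltrim P))).

(** Trimming divides by a power of the variable and drops zero leading coefficients. At a unit
    neither this nor a sign affects vanishing, so [K] needs only one representative of each form. *)
Definition up_to_sign (K : seq (seq int)) (P : seq int) : bool :=
  (trim P \in K) || ([seq - c | c <- trim P] \in K).

Definition every_class (s : nat) (p : pred (seq int)) (c : seq int) : bool :=
  all (fun l => p (coef_class s l c)) (iota 0 s).
Definition some_class (s : nat) (p : pred (seq int)) (c : seq int) : bool :=
  has (fun l => p (coef_class s l c)) (iota 0 s).

Section Peval.
Variables (R : comUnitRingType) (t : R).
Hypothesis t_unit : t \is a GRing.unit.

Lemma peval_opp P : peval t [seq - c | c <- P] = - peval t P.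
Proof.
by elim: P => [|c P /= ->]; rewrite ?oppr0 // mulrN rmorphN /= opprD.
Qed.

Lemma peval_ltrim P : exists k, peval t P = t ^+ k * peval t (ltrim P).
Proof.
elim: P => [|c P [k kE]] /=; first by exists 0%N; rewrite mulr0.
case: eqP => [->|_]; last by exists 0%N; rewrite mul1r.
by exists k.+1; rewrite add0r kE exprS mulrA.
Qed.

Lemma peval_rcons0 P : peval t (rcons P 0) = peval t P.
Proof. by elim: P => [|c P /= ->]; rewrite /= ?mulr0 ?addr0. Qed.

Lemma peval_rev_ltrim P : peval t (rev (ltrim P)) = peval t (rev P).
Proof.
elim: P => [//|c P IHP] /=; case: eqP => [->|_ //].
by rewrite rev_cons peval_rcons0.
Qed.

Lemma peval_trim P : exists2 u, u \is a GRing.unit & peval t P = u * peval t (trim P).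
Proof.
have [k ->] := peval_ltrim P; exists (t ^+ k); first exact: unitrX.
by rewrite /trim peval_rev_ltrim revK.
Qed.

Lemma up_to_sign_eq0 K P : (forall Q, Q \in K -> peval t Q = 0) ->
  up_to_sign K P -> peval t P = 0.
Proof.
have [u _ ->] := peval_trim P.
move=> KP /orP[/KP->|/KP]; rewrite ?mulr0 // peval_opp => /eqP.
by rewrite oppr_eq0 => /eqP->; rewrite mulr0.
Qed.

Lemma up_to_sign_neq0 K P : (forall Q, Q \in K -> peval t Q != 0) ->
  up_to_sign K P -> peval t P != 0.
Proof.
have [u u_unit ->] := peval_trim P => KP h.
apply/negP => /eqP h0; have {}h0 : peval t (trim P) = 0.
  by rewrite -(mulKr u_unit (peval t (trim P))) h0 mulr0.
by case/orP: h => /KP; rewrite ?peval_opp h0 ?oppr0 eqxx.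
Qed.

End Peval.

Lemma peval_int (R : pzRingType) (e : int) P :
  peval e%:~R P = (peval e P)%:~R :> R.
Proof.
elim: P => [//|c P IHP] /=; by rewrite rmorphD rmorphM /= IHP intz.
Qed.

Section Classes.
Variables (s n : nat) (r : 'Z_n).
Hypothesis r_unit : r \is a GRing.unit.

Lemma vec_coord J c (i : 'I_s) :
  vec s r J c 0 i = \sum_(j <- iota 0 20 | (i == (J + j) %% s :> nat)%N)
                     (c`_j)%:~R * r ^+ (J + j).
Proof.
rewrite /vec summxE -(big_mkord xpredT (fun j => ((c`_j)%:~R *: gen s r (J + j)) 0 i)).
rewrite [RHS]big_mkcond /=; apply: eq_bigr => j _; rewrite !mxE.
by case: eqP; rewrite ?mulr1 // !mulr0.
Qed.

(** For a concrete s the layers of the window in class l form an explicit list, so that [ring] can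
    finish; hence the restriction to s = 2, 3, 4. *)
Lemma vec_coord_class J c l (i : 'I_s) : (l < s)%N ->
  i = ((J + l) %% s)%N :> nat ->
  (s == 2) || (s == 3) || (s == 4) ->
  vec s r J c 0 i = r ^+ (J + l) * peval (r ^+ s) (coef_class s l c).
Proof.
move=> l_lt iE s234; rewrite vec_coord.
transitivity (\sum_(j <- iota 0 20 | (j %% s == l)%N) (c`_j)%:~R * r ^+ (J + j)).
  by apply: eq_bigl => j; rewrite iE eqn_modDl eq_sym [(l %% s)%N]modn_small.
rewrite -big_filter; move: l_lt; clear i iE.
case/orP: s234 => [/orP[]|] /eqP->; case: l => [|[|[|[|//]]]] // _;
  rewrite /coef_class [filter _ _]/= !big_cons big_nil !exprD /=;
  move: (r ^+ J) => x; ring.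
Qed.

Lemma every_class_vec (p : pred (seq int)) J c :
  (s == 2) || (s == 3) || (s == 4) ->
  (forall P, p P -> peval (r ^+ s) P = 0) ->
  every_class s p c -> vec s r J c = 0.
Proof.
move=> s234 pP /allP h; apply/rowP => i; rewrite mxE.
have s_gt0 : (0 < s)%N by apply: leq_ltn_trans (ltn_ord i).
(* This is i - J modulo s, kept within the natural numbers. *)
pose l := ((i + (s - J %% s)) %% s)%N.
have l_lt : (l < s)%N by apply: ltn_pmod.
have iE : i = ((J + l) %% s)%N :> nat.
  rewrite /l modnDmr addnCA -modnDmr -(modnDml J) subnKC ?(ltnW (ltn_pmod _ _)) //.
  by rewrite modnn addn0 modn_small.
rewrite (vec_coord_class c l_lt iE) // pP ?mulr0 //.
by apply: h; rewrite mem_iota.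
Qed.

Lemma some_class_vec (p : pred (seq int)) J c :
  (s == 2) || (s == 3) || (s == 4) ->
  (forall P, p P -> peval (r ^+ s) P != 0) ->
  some_class s p c -> vec s r J c != 0.
Proof.
move=> s234 pP /hasP[l]; rewrite mem_iota => /= l_lt /pP.
apply: contra => /eqP/rowP/(_ (Ordinal (ltn_pmod (J + l) (leq_ltn_trans (leq0n _) l_lt)))).
rewrite (vec_coord_class c l_lt) // mxE => h.
by rewrite -(mulKr (unitrX (J + l) r_unit) (peval _ _)) h mulr0.
Qed.

(* When s >= 5, no other layer of the same direction is closer than 5, so an
   isolated coefficient is a whole coordinate. *)
Definition isolated (K : seq int) (c : seq int) : bool :=
  has (fun p => ((c`_p \in K) || (- c`_p \in K)) &&
     all (fun q => (dist p q < 5)%N || (c`_q == 0)) (iota 0 20)) (iota 0 20).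

Lemma isolated_vec K J c : (5 <= s)%N ->
  (forall k, k \in K -> k%:~R != 0 :> 'Z_n) ->
  isolated K c -> vec s r J c != 0.
Proof.
move=> s_ge5 KP /hasP[p p_in /andP[cK /allP far]].
have s_gt0 : (0 < s)%N by apply: leq_trans s_ge5.
apply/negP => /eqP/rowP/(_ (Ordinal (ltn_pmod (J + p) s_gt0))).
rewrite vec_coord mxE big_mkcond (bigD1_seq p) ?iota_uniq //= eqxx.
rewrite big1_seq ?addr0 => [h|q /andP[ne q_in]].
  have c0 : (c`_p)%:~R = 0 :> 'Z_n.
    by rewrite -(mulrK (unitrX (J + p) r_unit) (c`_p)%:~R) h mul0r.
  by case/orP: cK => /KP; rewrite ?rmorphN /= c0 ?oppr0 eqxx.
case: eqP => // /eqP; rewrite eqn_modDl eqn_mod_dist => d.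
have /orP[near|/eqP->] := far q q_in; last by rewrite mul0r.
have d_gt0 : (0 < dist p q)%N by move: ne; rewrite /dist; lia.
by have := dvdn_leq d_gt0 d; rewrite leqNgt (leq_trans near s_ge5).
Qed.

End Classes.

(* Without this, failed unifications of two instances unfold the whole walk. *)
Opaque closed_walks.

Notation U b := ((true, b) : letter) (only parsing).
Notation D b := ((false, b) : letter) (only parsing).

Lemma Zn_int_eq0 n (k : int) : (1 < n)%N -> (k%:~R == 0 :> 'Z_n) = (n %| `|k|)%N.
Proof.
move=> n_gt1; case: k => k; first exact: Zn_nat_eq0.
by rewrite NegzE rmorphN oppr_eq0 Zn_nat_eq0 // abszN.
Qed.

Definition nonzero (R : pzRingType) (t : R) (P : seq int) : bool := peval t P != 0.
Definition vanishing (R : pzRingType) (t : R) (P : seq int) : bool := peval t P == 0.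

(** * Comparing turning and straight 2-arcs *)

Lemma sum_after_down (F : letter -> nat) :
  (\sum_(l <- letters | l != letter_inv (D false)) F l =
   F (U false) + F (D false) + F (D true))%N.
Proof. by rewrite /letters !big_cons !big_nil /= !addn0 !addnA. Qed.

Lemma sum_after_up (F : letter -> nat) :
  (\sum_(l <- letters | l != letter_inv (U false)) F l =
   F (U false) + F (U true) + F (D false))%N.
Proof. by rewrite /letters !big_cons !big_nil /= !addn0 !addnA. Qed.

(** In this and the next three lemmas the a's belong to the extensions of the turning 2-arc and the
    b's to those of the straight one. Here at most one faces at least two. *)
Lemma count_contra2 (Q : pred nat) (a1 a2 a3 b1 b2 b3 : nat) :
  (Q a1 + Q a2 + Q a3 = Q b1 + Q b2 + Q b3)%N ->
  ~~ Q a2 -> ~~ Q a3 -> Q b1 -> Q b2 -> False.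
Proof.
move=> e /negPf h2 /negPf h3 h4 h5; move: e; rewrite h2 h3 h4 h5.
by case: (Q a1); case: (Q b3).
Qed.

Lemma count_contra1 (Q : pred nat) (a1 a2 a3 b1 b2 b3 : nat) :
  (Q a1 + Q a2 + Q a3 = Q b1 + Q b2 + Q b3)%N ->
  ~~ Q a1 -> ~~ Q a2 -> ~~ Q a3 -> Q b1 || Q b2 -> False.
Proof.
move=> e /negPf h1 /negPf h2 /negPf h3 h; move: e h; rewrite h1 h2 h3.
by case: (Q b1); case: (Q b2).
Qed.

Lemma count_contra3 (Q : pred nat) (a1 a2 a3 b1 b2 b3 : nat) :
  (Q a1 + Q a2 + Q a3 = Q b1 + Q b2 + Q b3)%N ->
  Q a1 -> Q a2 -> Q a3 -> ~~ (Q b1 && Q b2) -> False.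
Proof.
move=> e h1 h2 h3 h; move: e h; rewrite h1 h2 h3.
by case: (Q b1); case: (Q b2); case: (Q b3).
Qed.

Lemma count_contra4 (Q : pred nat) (a1 a2 a3 b1 b2 b3 : nat) :
  (Q a1 + Q a2 + Q a3 = Q b1 + Q b2 + Q b3)%N ->
  Q a1 -> ~~ Q b1 -> ~~ Q b2 -> ~~ Q b3 -> False.
Proof. by move=> e h1 /negPf h2 /negPf h3 /negPf h4; move: e; rewrite h1 h2 h3 h4. Qed.

(** The divisors of 4 are 1, 2 and 4, and n is none of them. These constants are typical coordinates
    of short words. *)
Lemma small_neq0 n k : (3 <= n)%N -> n <> 4%N ->
  k \in [:: 1; 2; 4] -> k%:~R != 0 :> 'Z_n.
Proof.
move=> n_ge3 n_neq4; rewrite !inE => /or3P[] /eqP->;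
  rewrite Zn_int_eq0 ?absz_nat; try exact: ltnW.
- by rewrite dvdn1; apply/eqP; lia.
- by apply/negP => /(dvdn_leq (isT : (0 < 2)%N)); lia.
- apply/negP => h; have := dvdn_leq (isT : (0 < 4)%N) h.
  by move: n_ge3 n_neq4 h; case: (n) => [|[|[|[|[|]]]]].
Qed.

Lemma dvd12 N d : (3 <= N)%N ->
  d \in [:: 1; 2]%N -> ~~ (N %| d)%N.
Proof.
move=> N_ge3; rewrite !inE => /orP[] /eqP->.
  by rewrite dvdn1; apply/eqP; lia.
by apply/negP => /(dvdn_leq (isT : (0 < 2)%N)); lia.
Qed.

Lemma dvdn_of_eq0 N d : pred1 0%N d -> (N %| d)%N.
Proof. by move/eqP->; apply: dvdn0. Qed.

Lemma root_lift m s n (r : 'Z_n) : (3 <= m * s)%N ->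
  exists2 S : lifted s n, (9 <= S.1)%N & cov m r S = (0, 0).
Proof.
(* A lift of layer 0 with room below it for the symbolic window. *)
move=> ms_ge3; exists ((9 * (m * s))%N, 0); first by rewrite [_.1]/=; move: ms_ge3; lia.
rewrite /cov [_.1]/= [_.2]/=; congr pair; apply/eqP.
by rewrite Zn_nat_eq0; [apply: dvdn_mull|apply: ltnW].
Qed.

Section TwoArcRoot.
Variables (m s n : nat) (r : 'Z_n).
Hypothesis n_ge3 : (3 <= n)%N.
Hypothesis n_neq4 : n <> 4%N.
Hypothesis ms_ge3 : (3 <= m * s)%N.
Hypothesis r_unit : r \is a GRing.unit.
Hypothesis r_ms : r ^+ (m * s) = 1 \/ r ^+ (m * s) = -1.

Local Notation cov := (@cov m s n r).
Local Notation step := (@step s n r).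
Local Notation closed_walks := (@closed_walks m s n r).
Local Notation vec := (vec s r).

Let n_gt1 : (1 < n)%N. Proof. exact: ltnW. Qed.
Let ms_gt1 : (1 < m * s)%N. Proof. exact: ltnW. Qed.

Lemma closed_walks_ge (zl : pred nat) (zv : pred (seq int)) L (S : lifted s n) l1 l2 l3 :
  (forall d, zl d -> (m * s %| d)%N) -> (forall J c, zv c -> vec J c = 0) ->
  (L <= 6)%N -> (9 <= S.1)%N -> (sure_words zl zv L l1 l2 l3 <= closed_walks L S l1 l2 l3)%N.
Proof.
move=> zlP zvP L_le S_ge.
have := @closed_walks_bounds m s n r n_ge3 ms_ge3 r_unit r_ms zl pred0 zv pred0
  zlP (fun=> ltac:(by [])) zvP (fun _ _ => ltac:(by [])) L S l1 l2 l3 L_le S_ge.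
by case/andP.
Qed.

Lemma closed_walks_le (nl : pred nat) (nv : pred (seq int)) L (S : lifted s n) l1 l2 l3 :
  (forall d, nl d -> ~~ (m * s %| d)%N) -> (forall J c, nv c -> vec J c != 0) ->
  (L <= 6)%N -> (9 <= S.1)%N -> (closed_walks L S l1 l2 l3 <= possible_words nl nv L l1 l2 l3)%N.
Proof.
move=> nlP nvP L_le S_ge.
have := @closed_walks_bounds m s n r n_ge3 ms_ge3 r_unit r_ms pred0 nl pred0 nv
  (fun=> ltac:(by [])) nlP (fun _ _ => ltac:(by [])) nvP L S l1 l2 l3 L_le S_ge.
by case/andP.
Qed.

Lemma vec_all0 J c : all (pred1 0) c -> vec J c = 0.
Proof.
move=> /(all_nthP 0) c0; rewrite /vec big1 // => i _.
case: (ltnP i (size c)) => h; first by move/eqP: (c0 i h) => ->; rewrite scale0r.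
by rewrite nth_default // scale0r.
Qed.

Section Transitive.
Hypothesis Gamma_2at : two_arc_transitive (CPM m s n r).

Variable S : lifted s n.
Hypothesis S_ge9 : (9 <= S.1)%N.
Hypothesis S_root : cov S = (0, 0).

(** Both 2-arcs start at the root with the same step; each side runs over the three nonbacktracking
    extensions. The predicate [Q] selects which walk counts are compared. *)
Lemma turn_straight (Q : pred nat) L :
  (Q (closed_walks L S (U false) (D false) (U false)) +
   Q (closed_walks L S (U false) (D false) (D false)) +
   Q (closed_walks L S (U false) (D false) (D true)) =
   Q (closed_walks L S (U false) (U false) (U false)) +
   Q (closed_walks L S (U false) (U false) (U true)) +
   Q (closed_walks L S (U false) (U false) (D false)))%N.
Proof.
have S_gt2 : (2 < S.1)%N by apply: leq_trans S_ge9.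
have conn : connect (@sedge (CPMbar m s r)) (0, 0) (cov S).
  by rewrite S_root connect0.
have arc l2 : l2 != letter_inv (U false) ->
    two_arc (cov S, cov (step S (U false)), cov (step (step S (U false)) l2)).
  by move=> ne; apply: two_arc_cov => //; apply: ltnW.
have e1 := sum_after_down (fun l3 => Q (closed_walks L S (U false) (D false) l3) : nat).
have e2 := sum_after_up (fun l3 => Q (closed_walks L S (U false) (U false) l3) : nat).
have f1 := ext_count_cov n_ge3 ms_ge3 r_unit r_ms Q L (U false) (D false) S_gt2.
have f2 := ext_count_cov n_ge3 ms_ge3 r_unit r_ms Q L (U false) (U false) S_gt2.
have e := two_arc_transitive_ext_count Gamma_2at (arc (D false) isT)
  (arc (U false) isT) conn conn Q L.
exact: etrans (esym e1) (etrans (esym f1) (etrans e (etrans f2 e2))).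
Qed.

(** The commutator octagon covers both down extensions of up-down. For s >= 5 nothing covers
    up-up-up: each word is off by one or two layers or has an isolated coefficient 1, 2 or 4 up to
    sign. *)
Lemma s_lt5 : (s < 5)%N.
Proof.
rewrite ltnNge; apply/negP => s_ge5.
have straight0 b : closed_walks 6 S (U false) (U false) (U b) = 0%N.
  apply/eqP; rewrite -leqn0.
  have nvP J c : isolated [:: 1; 2; 4] c -> vec J c != 0.
    by apply: isolated_vec => // k; apply: small_neq0.
  apply: leq_trans (closed_walks_le (L := 6%N) (U false) (U false) (U b) (fun d => @dvd12 _ d ms_ge3) nvP isT S_ge9) _.
  by case: b; vm_compute.
have turn0 b : (0 < closed_walks 6 S (U false) (D false) (D b))%N.
  apply: leq_trans (closed_walks_ge (L := 6%N) (U false) (D false) (D b) (@dvdn_of_eq0 _) vec_all0 isT S_ge9).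
  by case: b; vm_compute.
apply: (count_contra2 (turn_straight (pred1 0%N) 6)).
- by rewrite [pred1 _ _]eqn0Ngt turn0.
- by rewrite [pred1 _ _]eqn0Ngt turn0.
- by rewrite straight0.
- by rewrite straight0.
Qed.

End Transitive.
End TwoArcRoot.

Definition trim_or_up_to_sign (K : seq (seq int)) (P : seq int) : bool :=
  (trim P == [::]) || up_to_sign K P.

Definition eval_small (e : int) (P : seq int) : bool :=
  `|peval e P|%N \in [:: 1; 2; 4]%N.
Definition eval_zero (e : int) (P : seq int) : bool := peval e P == 0.

Section Classes.
Variables (m s n : nat) (r : 'Z_n).
Hypothesis n_ge3 : (3 <= n)%N.
Hypothesis n_neq4 : n <> 4%N.
Hypothesis ms_ge3 : (3 <= m * s)%N.
Hypothesis r_unit : r \is a GRing.unit.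
Hypothesis r_ms : r ^+ (m * s) = 1 \/ r ^+ (m * s) = -1.
Hypothesis s234 : (s == 2) || (s == 3) || (s == 4).

Local Notation closed_walks := (@closed_walks m s n r).
Let n_gt1 : (1 < n)%N. Proof. exact: ltnW. Qed.

Lemma class_upp (nl : pred nat) (p : pred (seq int)) L (S : lifted s n) l1 l2 l3 k :
  (9 <= S.1)%N -> (L <= 6)%N ->
  (forall d, nl d -> ~~ (m * s %| d)%N) ->
  (forall P, p P -> peval (r ^+ s) P != 0) ->
  (possible_words nl (some_class s p) L l1 l2 l3 <= k)%N -> (closed_walks L S l1 l2 l3 <= k)%N.
Proof.
move=> S_ge L_le nlP pP; apply: leq_trans.
apply: (closed_walks_le n_ge3 ms_ge3 r_unit r_ms l1 l2 l3 nlP _ L_le S_ge).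
by move=> J c; apply: some_class_vec.
Qed.

Lemma class_low (zl : pred nat) (p : pred (seq int)) L (S : lifted s n) l1 l2 l3 k :
  (9 <= S.1)%N -> (L <= 6)%N ->
  (forall d, zl d -> (m * s %| d)%N) ->
  (forall P, p P -> peval (r ^+ s) P = 0) ->
  (k <= sure_words zl (every_class s p) L l1 l2 l3)%N -> (k <= closed_walks L S l1 l2 l3)%N.
Proof.
move=> S_ge L_le zlP pP h; apply: leq_trans h _.
apply: (closed_walks_ge n_ge3 ms_ge3 r_unit r_ms l1 l2 l3 zlP _ L_le S_ge).
by move=> J c; apply: every_class_vec.
Qed.

Lemma up_to_sign_nonzero K : all (nonzero (r ^+ s)) K ->
  forall P, up_to_sign K P -> peval (r ^+ s) P != 0.
Proof.
by move=> /allP KP P; apply: (up_to_sign_neq0 (unitrX s r_unit)) => Q /KP.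
Qed.

Lemma up_to_sign_vanishing K : all (vanishing (r ^+ s)) K ->
  forall P, trim_or_up_to_sign K P -> peval (r ^+ s) P = 0.
Proof.
move=> /allP KP P /orP[/eqP e|].
  by have [u _ ->] := peval_trim (unitrX s r_unit) P; rewrite e mulr0.
by apply: (up_to_sign_eq0 (unitrX s r_unit)) => Q /KP/eqP.
Qed.

Lemma eval_small_nonzero e : r ^+ s = e%:~R ->
  forall P, eval_small e P -> peval (r ^+ s) P != 0.
Proof.
move=> -> P; rewrite /eval_small peval_int Zn_int_eq0 // !inE.
have nk k : k \in [:: 1; 2; 4]%N -> ~~ (n %| k)%N.
  by move=> k_in; have := small_neq0 (k := k) n_ge3 n_neq4; rewrite Zn_int_eq0 // absz_nat;
    apply; move: k_in; rewrite !inE => /or3P[] /eqP->.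
by move=> h; apply: nk; rewrite !inE.
Qed.

Lemma eval_zero_vanishing e : r ^+ s = e%:~R ->
  forall P, eval_zero e P -> peval (r ^+ s) P = 0.
Proof. by move=> -> P /eqP h; rewrite peval_int h. Qed.

End Classes.

(** * Excluding three and four directions *)

Section AtLeastThreeDirections.
Variables (m s n : nat) (r : 'Z_n).
Hypothesis m_gt0 : (0 < m)%N.
Hypothesis n_ge3 : (3 <= n)%N.
Hypothesis n_neq4 : n <> 4%N.
Hypothesis ms_ge3 : (3 <= m * s)%N.
Hypothesis r_unit : r \is a GRing.unit.
Hypothesis r_ms : r ^+ (m * s) = 1 \/ r ^+ (m * s) = -1.
Hypothesis Gamma_2at : two_arc_transitive (CPM m s n r).
Let n_gt1 : (1 < n)%N. Proof. exact: ltnW. Qed.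

Lemma sign_case (x : 'Z_n) : x = 1 \/ x = -1 ->
  exists2 e : int, (e == 1) || (e == -1) & x = e%:~R.
Proof. by case=> ->; [exists 1|exists (-1)] => //; rewrite rmorphN. Qed.

(** The commutator octagon closes without any relation in [Z_n], hence the empty list of vanishing
    forms. *)
Lemma turn_low (S : lifted s n) b : s = 4 \/ s = 3 -> (9 <= S.1)%N ->
  (0 < closed_walks m r 6 S (U false) (D false) (D b))%N.
Proof.
move=> s34 S_ge.
apply: (class_low (L := 6%N) n_ge3 ms_ge3 r_unit r_ms _ S_ge isT (@dvdn_of_eq0 (m * s))
  (p := trim_or_up_to_sign [::])).
- by case: s34 => ->.
- exact: up_to_sign_vanishing.
- by case: s34 => ->; case: b; vm_compute.
Qed.

Lemma straight_not_zero (S : lifted s n) : s = 4 \/ s = 3 -> (9 <= S.1)%N ->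
  cov m r S = (0, 0) ->
  (forall b, closed_walks m r 6 S (U false) (U false) (U b) = 0%N) -> False.
Proof.
move=> s34 S_ge S_root z.
have turn0 b : (0 < closed_walks m r 6 S (U false) (D false) (D b))%N by apply: turn_low.
apply: (count_contra2 (turn_straight n_ge3 ms_ge3 r_unit r_ms Gamma_2at
    S_ge S_root (pred1 0%N) 6)).
- by rewrite [pred1 _ _]eqn0Ngt turn0.
- by rewrite [pred1 _ _]eqn0Ngt turn0.
- by rewrite z.
- by rewrite z.
Qed.

Lemma peval1 (R : pzRingType) (t : R) a : peval t [:: a] = a%:~R.
Proof. by rewrite /= mulr0 addr0. Qed.

Lemma peval2 (R : pzRingType) (t : R) a b : peval t [:: a; b] = a%:~R + t * b%:~R.
Proof. by rewrite /= mulr0 addr0. Qed.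

Lemma s_neq4 : s <> 4.
Proof.
move=> s4; have [S S_ge S_root] := root_lift r ms_ge3.
have s234 : (s == 2) || (s == 3) || (s == 4) by rewrite s4.
have nz k : k \in [:: 1; 2; 4] -> nonzero (r ^+ s) [:: k].
  by rewrite /nonzero peval1; apply: small_neq0.
have straight0 := straight_not_zero (or_introl s4) S_ge S_root.
(* For m > 2 neither 4 nor 8 is a multiple of 4m, so no octagon wraps around and up-up-up lies on
   none. *)
have [m_le2|m_gt2] := leqP m 2; last first.
  apply: straight0 => b; apply/eqP; rewrite -leqn0.
  apply: (class_upp (L := 6%N) n_ge3 ms_ge3 r_unit r_ms s234 S_ge isT
    (nl := fun d => ~~ (4 %| d)%N || (d == 4)%N || (d == 8)%N)
    (p := up_to_sign [:: [:: 1]; [:: 2]; [:: 4]])).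
  - move=> d; rewrite s4 => /orP[/orP[]|/eqP->].
    + by apply: contra => /(dvdn_trans (dvdn_mull _ _)); apply.
    + by move/eqP->; apply/negP => /dvdn_leq; lia.
    + by apply/negP => /dvdn_leq; lia.
  - by apply: up_to_sign_nonzero => //; rewrite /= !nz.
  - by rewrite s4; case: b; vm_compute.
have [t1|t1] := boolP ((r ^+ s == 1) || (r ^+ s == -1)).
  have [e eE tE] : exists2 e : int, (e == 1) || (e == -1) & r ^+ s = e%:~R.
    by apply: sign_case; case/orP: t1 => /eqP; [left|right].
  have upp1 l1 l2 l3 : (possible_words (fun d => ~~ (4 %| d)%N) (some_class 4 (eval_small e)) 6 l1 l2 l3 <= 1)%N ->
      (closed_walks m r 6 S l1 l2 l3 <= 1)%N.
    move=> h; apply: (class_upp (L := 6%N) n_ge3 ms_ge3 r_unit r_ms s234 S_ge isT _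
      (eval_small_nonzero n_ge3 n_neq4 tE)); last by rewrite s4; apply: h.
    by move=> d; rewrite s4; apply: contra => /(dvdn_trans (dvdn_mull _ _)); apply.
  (* Eight steps up: the last four retrace the directions of the first four, and [r ^+ 4 = e]
     determines their signs. Up-up-up leaves one sign free, hence two octagons. *)
  have low2 : (2 <= closed_walks m r 6 S (U false) (U false) (U false))%N.
    apply: (class_low (L := 6%N) n_ge3 ms_ge3 r_unit r_ms s234 S_ge isT
      (zl := fun d => (8 %| d)%N) _ (eval_zero_vanishing tE)).
      move=> d; rewrite s4; apply: dvdn_trans.
      by move: m_gt0 m_le2; case: (m) => [|[|[|]]].
    by rewrite s4; case/orP: eE => /eqP->; vm_compute.
  apply: (count_contra1 (turn_straight n_ge3 ms_ge3 r_unit r_ms Gamma_2at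
    S_ge S_root (fun k => (2 <= k)%N) 6)); rewrite -?ltnNge ?low2 //; 
    by rewrite ltnS; apply: upp1; case/orP: eE => /eqP->; vm_compute.
have [t1n t1n'] : r ^+ s != 1 /\ r ^+ s != -1 by apply/andP; rewrite -negb_or.
(* m = 1 would make [r ^+ 4] equal to 1 or -1, the case just treated. *)
have m2 : m = 2.
  case: m m_gt0 m_le2 r_ms t1n t1n' => [|[|[|]]] // _ _.
  by rewrite mul1n => -[] ->; rewrite eqxx.
apply: straight0 => b; apply/eqP; rewrite -leqn0.
apply: (class_upp (L := 6%N) n_ge3 ms_ge3 r_unit r_ms s234 S_ge isT
  (nl := fun d => ~~ (8 %| d)%N)
  (p := up_to_sign [:: [:: 1]; [:: 2]; [:: 4]; [:: 1; 1]; [:: 1; -1]])).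
- by move=> d; rewrite s4 m2.
- apply: up_to_sign_nonzero => //; rewrite /= !nz // /nonzero !peval2.
  rewrite mulr1 mulrN1 addrC addr_eq0 t1n' subr_eq0 eq_sym t1n; by [].
- by rewrite s4; case: b; vm_compute.
Qed.

Lemma s_neq3 : s <> 3.
Proof.
move=> s3; have [S S_ge S_root] := root_lift r ms_ge3.
have s234 : (s == 2) || (s == 3) || (s == 4) by rewrite s3.
have nz k : k \in [:: 1; 2; 4] -> nonzero (r ^+ s) [:: k].
  by rewrite /nonzero peval1; apply: small_neq0.
have straight0 := straight_not_zero (or_intror s3) S_ge S_root.
(* If 2t = 2e for [t = r ^+ 3], the octagons of type up-up-up-up-down-down-down-down close too, as
   the first and the fourth layer climbed share a direction. Each up-down-down lies on two of them,
   one for each sign of the middle layer left free, besides the commutator. *)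
have many (e : int) : (e == 1) || (e == -1) -> vanishing (r ^+ s) [:: 2; - (2 * e)] ->
    (forall b, closed_walks m r 6 S (U false) (U false) (U b) <= 2)%N -> False.
  move=> eE te le2.
  have low3 b : (3 <= closed_walks m r 6 S (U false) (D false) (D b))%N.
    apply: (class_low (L := 6%N) n_ge3 ms_ge3 r_unit r_ms s234 S_ge isT
      (@dvdn_of_eq0 (m * s)) (p := trim_or_up_to_sign [:: [:: 2; - (2 * e)]])).
      by apply: up_to_sign_vanishing => //; rewrite /= te.
    by rewrite s3; case/orP: eE => /eqP->; case: b; vm_compute.
  apply: (count_contra2 (turn_straight n_ge3 ms_ge3 r_unit r_ms Gamma_2at
    S_ge S_root (fun k => (k <= 2)%N) 6)); rewrite -?ltnNge ?low3 //; exact: le2.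
have [t1|t1] := boolP ((r ^+ s == 1) || (r ^+ s == -1)).
  have [e eE tE] : exists2 e : int, (e == 1) || (e == -1) & r ^+ s = e%:~R.
    by apply: sign_case; case/orP: t1 => /eqP; [left|right].
  apply: (many e eE).
    rewrite /vanishing peval2 tE -rmorphM -rmorphD.
    by case/orP: eE => /eqP->.
  move=> b; apply: (class_upp (L := 6%N) n_ge3 ms_ge3 r_unit r_ms s234 S_ge isT
      (nl := fun d => ~~ (3 %| d)%N) _ (eval_small_nonzero n_ge3 n_neq4 tE)).
    by move=> d; rewrite s3; apply: contra => /(dvdn_trans (dvdn_mull _ _)); apply.
  by rewrite s3; case/orP: eE => /eqP->; case: b; vm_compute.
have [t1n t1n'] : r ^+ s != 1 /\ r ^+ s != -1 by apply/andP; rewrite -negb_or.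
have m_gt1 : (1 < m)%N.
  case: m m_gt0 r_ms t1n t1n' => [|[|]] // _.
  by rewrite mul1n => -[] ->; rewrite eqxx.
pose nl d := ~~ (3 %| d)%N || (d == 3)%N.
have nlP d : nl d -> ~~ (m * s %| d)%N.
  rewrite s3 => /orP[|/eqP->].
    by apply: contra => /(dvdn_trans (dvdn_mull _ _)); apply.
  by apply/negP => /dvdn_leq; lia.
pose K : seq (seq int) := [:: [:: 1]; [:: 2]; [:: 4]; [:: 1; 1]; [:: 1; -1]].
have KP : all (nonzero (r ^+ s)) K.
  rewrite /= !nz // /nonzero !peval2.
  by rewrite mulr1 mulrN1 addrC addr_eq0 t1n' subr_eq0 eq_sym t1n.
have upper K' k : all (nonzero (r ^+ s)) (K ++ K') ->
    (forall b, possible_words nl (some_class 3 (up_to_sign (K ++ K'))) 6 (U false) (U false) (U b) <= k)%N ->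
    forall b, (closed_walks m r 6 S (U false) (U false) (U b) <= k)%N.
  move=> K'P h b; apply: (class_upp (L := 6%N) n_ge3 ms_ge3 r_unit r_ms s234 S_ge isT nlP
      (p := up_to_sign (K ++ K'))); first exact: up_to_sign_nonzero.
  by rewrite s3; apply: h.
have four (e : int) : vanishing (r ^+ s) [:: 2; - (2 * e)] ->
    nonzero (r ^+ s) [:: 2; 2 * e].
  rewrite /vanishing /nonzero !peval2 rmorphN mulrN subr_eq0 => /eqP <-.
  by rewrite -rmorphD; apply: small_neq0.
have [te|tn1] := boolP (vanishing (r ^+ s) [:: 2; - (2 * 1)]).
  apply: (many 1 isT te); apply: (upper [:: [:: 2; 2]]).
    by rewrite all_cat KP /= andbT; exact: four te.
  by case; vm_compute.
have [te|tn2] := boolP (vanishing (r ^+ s) [:: 2; - (2 * -1)]).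
  apply: (many (-1) isT te); apply: (upper [:: [:: 2; -2]]).
    by rewrite all_cat KP /= andbT; exact: four te.
  by case; vm_compute.
apply: straight0 => b; apply/eqP; rewrite -leqn0; move: b.
apply: (upper [:: [:: 2; 2]; [:: 2; -2]]).
  by rewrite all_cat KP /= andbT /nonzero tn2; exact: tn1.
by case; vm_compute.
Qed.

Lemma s_eq2 : (2 <= s)%N -> s = 2.
Proof.
have [S S_ge S_root] := root_lift r ms_ge3.
have := s_lt5 n_ge3 n_neq4 ms_ge3 r_unit r_ms Gamma_2at S_ge S_root.
have := s_neq3; have := s_neq4.
by case: (s) => [|[|[|[|[|]]]]].
Qed.

End AtLeastThreeDirections.

(** * Two directions: squares with 2q != 2 and 2q != -2 *)

(** The units modulo 24 have exponent 2; all divisors of 24 are checked exhaustively. *)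
Lemma unit_sqr_dvd24 n (r : 'Z_n) : (1 < n)%N -> r \is a GRing.unit ->
  (n %| 24)%N -> r ^+ 2 = 1.
Proof.
move=> n_gt1; rewrite {1 2}(Zn_natE r n_gt1) unitZpE // => co n_dvd.
apply/eqP; rewrite -natrX -[1]/(1%:R) Zn_nat_eq //.
have n_in : n \in iota 0 25 by rewrite mem_iota ltnS (dvdn_leq _ n_dvd).
have k_in : (r : nat) \in iota 0 n.
  by rewrite mem_iota -[X in (_ < _ + X)%N](Zp_cast n_gt1) ltn_ord.
suff /allP/(_ n n_in)/implyP/(_ n_dvd)/allP/(_ _ k_in)/implyP/(_ co) :
  all (fun n => (n %| 24)%N ==>
    all (fun k => coprime n k ==> (k ^ 2 == 1 %[mod n])%N) (iota 0 n)) (iota 0 25) by [].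
by vm_compute.
Qed.

(** The units modulo 30 have exponent lcm(1, 2, 4) = 4; the factor 6 fits the eliminations below. *)
Lemma unit_pow4_dvd30 n (r : 'Z_n) : (1 < n)%N -> r \is a GRing.unit ->
  (n %| 30)%N -> 6 * r ^+ 4 = 6.
Proof.
move=> n_gt1; rewrite {1 2}(Zn_natE r n_gt1) unitZpE // => co n_dvd.
apply/eqP; rewrite -natrX -natrM Zn_nat_eq // (expnM _ 2 2) -modnMmr -modnXm modnMmr.
have n_in : n \in iota 0 31 by rewrite mem_iota ltnS (dvdn_leq _ n_dvd).
have k_in : (r : nat) \in iota 0 n.
  by rewrite mem_iota -[X in (_ < _ + X)%N](Zp_cast n_gt1) ltn_ord.
suff /allP/(_ n n_in)/implyP/(_ n_dvd)/allP/(_ _ k_in)/implyP/(_ co) :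
  all (fun n => (n %| 30)%N ==>
    all (fun k => coprime n k ==> (6 * (k ^ 2 %% n) ^ 2 == 6 %[mod n])%N) (iota 0 n)) (iota 0 31) by [].
by vm_compute.
Qed.

Section Identities.
Variables (R : comNzRingType) (x : R).

(** This and the next lemmas are elimination certificates: the constant is written as a combination
    of the vanishing expressions. x will be q or -q, or the inverse of one of them. *)
Lemma four_two_mod30 : 4 + 2 * x = 0 -> 6 * x ^+ 2 = 6 -> 30 = 0 :> R -> 6 = 0 :> R.
Proof.
move=> h1 h2 h3.
have -> : 6 = 2 * ((4 + 2 * x) * (6 - 3 * x) + (6 * x ^+ 2 - 6)) - 30 :> R by ring.
by rewrite h1 h2 h3 mul0r subrr addr0 mulr0 subrr.
Qed.

Lemma two_four_mod30 : 2 + 4 * x = 0 -> 6 * x ^+ 2 = 6 -> 30 = 0 :> R -> 6 = 0 :> R.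
Proof.
move=> h1 h2 h3.
have -> : 6 = - 2 * (3 * ((2 + 4 * x) * (1 - 2 * x)) + 4 * (6 * x ^+ 2 - 6)) - 30 :> R by ring.
by rewrite h1 h2 h3 mul0r subrr !mulr0 addr0 mulr0 subrr.
Qed.

Lemma four_two_two_four (e : R) : e = 1 \/ e = -1 ->
  4 + 2 * x = 0 -> 2 + 4 * (e * x) = 0 -> 30 = 0 :> R.
Proof.
case=> -> h1 h2.
  have -> : 30 = 5 * (2 * (4 + 2 * x) - (2 + 4 * (1 * x))) :> R by ring.
  by rewrite h1 h2 mulr0 subrr mulr0.
have -> : 30 = 3 * (2 * (4 + 2 * x) + (2 + 4 * (-1 * x))) :> R by ring.
by rewrite h1 h2 mulr0 addr0 mulr0.
Qed.

Lemma four_two_sqr : x ^+ 2 = 1 \/ x ^+ 2 = -1 -> 4 + 2 * x = 0 -> 30 = 0 :> R.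
Proof.
case=> h1 h2.
  have -> : 30 = 5 * ((4 + 2 * x) * (2 - x) + 2 * (x ^+ 2 - 1)) :> R by ring.
  by rewrite h1 h2 mul0r subrr mulr0 addr0 mulr0.
have -> : 30 = 3 * ((4 + 2 * x) * (2 - x) + 2 * (x ^+ 2 + 1)) :> R by ring.
by rewrite h1 h2 mul0r addNr mulr0 addr0 mulr0.
Qed.

Lemma two_four_sqr : x ^+ 2 = 1 \/ x ^+ 2 = -1 -> 2 + 4 * x = 0 -> 30 = 0 :> R.
Proof.
case=> h1 h2.
  have -> : 30 = - 5 * ((2 + 4 * x) * (1 - 2 * x) + 8 * (x ^+ 2 - 1)) :> R by ring.
  by rewrite h1 h2 mul0r subrr mulr0 addr0 mulr0.
have -> : 30 = 3 * ((2 + 4 * x) * (1 - 2 * x) + 8 * (x ^+ 2 + 1)) :> R by ring.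
by rewrite h1 h2 mul0r addNr mulr0 addr0 mulr0.
Qed.

(** Multiplying 4 + 2x by (2 - x)(4 + x^2) gives 2(16 - x^4), whence 30 and 34. *)
Lemma four_two_pow4 : x ^+ 4 = 1 \/ x ^+ 4 = -1 -> 4 + 2 * x = 0 ->
  30 = 0 :> R \/ 34 = 0 :> R.
Proof.
case=> h1 h2; [left|right].
  have -> : 30 = (4 + 2 * x) * (2 - x) * (4 + x ^+ 2) + 2 * (x ^+ 4 - 1) :> R by ring.
  by rewrite h1 h2 !mul0r subrr mulr0 addr0.
have -> : 34 = (4 + 2 * x) * (2 - x) * (4 + x ^+ 2) + 2 * (x ^+ 4 + 1) :> R by ring.
by rewrite h1 h2 !mul0r addNr mulr0 addr0.
Qed.

End Identities.

(* The sporadic octagons, of type up-up-up-down-down-down-up-down, close exactly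
   when one of 4 + 2q, 4 - 2q, 2 + 4q, 2 - 4q vanishes. *)
Definition four_two (b : bool) : seq int := [:: 4; (-1) ^+ b * 2].
Definition two_four (b : bool) : seq int := [:: 2; (-1) ^+ b * 4].
Definition generic_forms : seq (seq int) :=
  [:: [:: 1]; [:: 2]; [:: 4]; [:: 8]; [:: 1; 1]; [:: 1; -1]; [:: 2; 2]; [:: 2; -2]].

Lemma all_cons (T : Type) (p : pred T) x l : all p (x :: l) = p x && all p l.
Proof. by []. Qed.

Section Arithmetic.
Variables (n : nat) (r : 'Z_n).
Hypothesis n_ge3 : (3 <= n)%N.
Hypothesis n_neq4 : n <> 4%N.
Hypothesis r_unit : r \is a GRing.unit.
Let n_gt1 : (1 < n)%N. Proof. exact: ltnW. Qed.
Local Notation q := (r ^+ 2).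

Lemma peval2_sign b (c d : int) :
  peval q [:: c; (-1) ^+ b * d] = c%:~R + d%:~R * ((-1) ^+ b * q).
Proof. by rewrite peval2 rmorphM rmorphXn rmorphN1; ring. Qed.

Lemma Zn_small_eq0 (k l : nat) : (k%:R : 'Z_n) = 0 -> (l%:R : 'Z_n) = 0 ->
  ((gcdn k l)%:R : 'Z_n) = 0.
Proof.
by move=> /eqP + /eqP; rewrite !Zn_nat_eq0 // => h1 h2; apply/eqP; rewrite Zn_nat_eq0 // dvdn_gcd h1.
Qed.

Lemma two_neq0 : (2 : 'Z_n) != 0.
Proof. exact: (small_neq0 (k := 2) n_ge3 n_neq4). Qed.

Lemma four_neq0 : (4 : 'Z_n) != 0.
Proof. exact: (small_neq0 (k := 4) n_ge3 n_neq4). Qed.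

Section GenericSquare.
Hypothesis q2p : nonzero q [:: 2; 2].
Hypothesis q2m : nonzero q [:: 2; -2].

(** If n divides 24 then q = 1, against 2q != 2. This is what keeps 6 and 8 from vanishing. *)
Lemma dvd24_contra : (24 : 'Z_n) = 0 -> False.
Proof.
move=> /eqP; rewrite Zn_nat_eq0 // => /(unit_sqr_dvd24 n_gt1 r_unit) q1.
by move/negP: q2m; apply; rewrite peval2 q1 mul1r -rmorphD.
Qed.

Lemma eight_neq0 : (8 : 'Z_n) != 0.
Proof.
apply/eqP => h; apply: dvd24_contra.
have -> : 24 = 3 * 8 :> 'Z_n by ring.
by rewrite h mulr0.
Qed.

Lemma six_neq0 : (6 : 'Z_n) != 0.
Proof.
apply/eqP => h; apply: dvd24_contra.
have -> : 24 = 4 * 6 :> 'Z_n by ring.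
by rewrite h mulr0.
Qed.

Lemma generic_forms_nonzero : all (nonzero q) generic_forms.
Proof.
have one (P : seq int) (k : int) : nonzero q [seq 2 * c | c <- P] -> nonzero q P.
  apply: contra => /eqP h; apply/eqP.
  suff -> : peval q [seq 2 * c | c <- P] = 2 * peval q P by rewrite h mulr0.
  by elim: P {h} => [|c P /= ->]; rewrite /= ?mulr0 // rmorphM mulrDr mulrCA.
have n11 := one [:: 1; 1] 1 q2p; have n1N := one [:: 1; -1] 1 q2m.
have small k : k \in [:: 1; 2; 4] -> nonzero q [:: k].
  by rewrite /nonzero peval1; apply: small_neq0.
have n8 : nonzero q [:: 8] by rewrite /nonzero peval1; exact: eight_neq0.
by rewrite /generic_forms !all_cons (small 1) // (small 2) // (small 4) // n8 n11 n1N q2p q2m.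
Qed.

Lemma sign_sqr b : ((-1) ^+ b * q) ^+ 2 = q ^+ 2.
Proof. by rewrite exprMn sqrr_sign mul1r. Qed.

Lemma dvd30_six b : (30 : 'Z_n) = 0 -> 6 * ((-1) ^+ b * q) ^+ 2 = 6.
Proof.
move=> /eqP; rewrite Zn_nat_eq0 // sign_sqr -exprM => h.
exact: unit_pow4_dvd30.
Qed.

Lemma four_two_dvd30 b : vanishing q (four_two b) -> (30 : 'Z_n) = 0 -> False.
Proof.
rewrite /vanishing peval2_sign => /eqP h h30; move/eqP: six_neq0; apply.
exact: (four_two_mod30 h (dvd30_six b h30) h30).
Qed.

Lemma two_four_dvd30 b : vanishing q (two_four b) -> (30 : 'Z_n) = 0 -> False.
Proof.
rewrite /vanishing peval2_sign => /eqP h h30; move/eqP: six_neq0; apply.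
exact: (two_four_mod30 h (dvd30_six b h30) h30).
Qed.

Lemma four_two_two_four_contra b c :
  vanishing q (four_two b) -> vanishing q (two_four c) -> False.
Proof.
move=> h1 h2; apply: (four_two_dvd30 h1); move: h1 h2.
rewrite /vanishing !peval2_sign => /eqP h1 /eqP h2.
apply: (four_two_two_four (e := (-1) ^+ (c (+) b)) _ h1).
  by case: (c (+) b); [right|left].
by rewrite signr_addb -!mulrA (mulrA ((-1) ^+ b)) -signr_addb addbb mul1r.
Qed.

Lemma four_two_neg b : vanishing q (four_two b) -> nonzero q (four_two (~~ b)).
Proof.
rewrite /vanishing /nonzero !peval2_sign => /eqP h; apply: contra eight_neq0 => /eqP h'.
have -> : 8 = (4 + 2 * ((-1) ^+ b * q)) + (4 + 2 * ((-1) ^+ (~~ b) * q)) :> 'Z_n.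
  by rewrite signrN; ring.
by rewrite h h' addr0.
Qed.

Lemma two_four_neg b : vanishing q (two_four b) -> nonzero q (two_four (~~ b)).
Proof.
rewrite /vanishing /nonzero !peval2_sign => /eqP h; apply: contra four_neq0 => /eqP h'.
have -> : 4 = (2 + 4 * ((-1) ^+ b * q)) + (2 + 4 * ((-1) ^+ (~~ b) * q)) :> 'Z_n.
  by rewrite signrN; ring.
by rewrite h h' addr0.
Qed.

(** At most one of the four forms vanishes: opposite signs of the same type add up to 8 or 4, and
    one form of each type forces 30 = 0 and then 6 = 0. *)
Lemma special_cases :
  [\/ all (nonzero q) [:: four_two false; four_two true; two_four false; two_four true],
   exists2 b, vanishing q (four_two b) &
     all (nonzero q) [:: four_two (~~ b); two_four false; two_four true] |
   exists2 b, vanishing q (two_four b) &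
     all (nonzero q) [:: two_four (~~ b); four_two false; four_two true]].
Proof.
have [|n1] := boolP (vanishing q (four_two false) || vanishing q (four_two true)).
  move=> h; have {h}[b h] : exists b, vanishing q (four_two b).
    by case/orP: h => h; [exists false|exists true].
  constructor 2; exists b => //.
  have nz c : nonzero q (two_four c).
    by apply/negP => h'; apply: (four_two_two_four_contra h h').
  by rewrite !all_cons four_two_neg // !nz.
have [|n2] := boolP (vanishing q (two_four false) || vanishing q (two_four true)).
  move=> h; have {h}[b h] : exists b, vanishing q (two_four b).
    by case/orP: h => h; [exists false|exists true].
  constructor 3; exists b => //.
  have nz c : nonzero q (four_two c).
    by apply/negP => h'; apply: (four_two_two_four_contra h' h).
  by rewrite !all_cons two_four_neg // !nz.
constructor 1; rewrite !all_cons.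
have nz P : ~~ vanishing q P -> nonzero q P by [].
move: n1 n2; rewrite !negb_or.
by move=> /andP[/nz-> /nz->] /andP[/nz-> /nz->].
Qed.

Lemma special_sqr : q ^+ 2 = 1 \/ q ^+ 2 = -1 ->
  all (nonzero q) [:: four_two false; four_two true; two_four false; two_four true].
Proof.
move=> q2; have sq b : ((-1) ^+ b * q) ^+ 2 = 1 \/ ((-1) ^+ b * q) ^+ 2 = -1.
  by rewrite sign_sqr.
case: special_cases => // -[b h _]; exfalso; move: (h); rewrite /vanishing peval2_sign => /eqP h'.
  exact: (four_two_dvd30 h (four_two_sqr (sq b) h')).
exact: (two_four_dvd30 h (two_four_sqr (sq b) h')).
Qed.

(** For x = q or -q, the conjugate 3 - x turns 3 + x into 9 - x^2, which is 8 or 10. If 10 = 0, the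
    exponent modulo 30 gives 6 x^2 = 6, hence 48 = 0 and gcd(48, 10) = 2 vanishes. The form 1 + 3x
    is handled in the same way. *)
Lemma three_one_nonzero : q ^+ 2 = 1 \/ q ^+ 2 = -1 ->
  all (nonzero q) [:: [:: 3; 1]; [:: 3; -1]; [:: 1; 3]; [:: 1; -3]].
Proof.
move=> q2.
have contra10 : (48 : 'Z_n) = 0 -> (10 : 'Z_n) = 0 -> False.
  move=> h1 h2; move/eqP: two_neq0; apply.
  exact: (Zn_small_eq0 (k := 48) (l := 10)).
have q6 : (10 : 'Z_n) = 0 -> 6 * q ^+ 2 = 6.
  move=> h; have h30 : (30 : 'Z_n) = 0.
    have -> : 30 = 3 * 10 :> 'Z_n by ring.
    by rewrite h mulr0.
  by have := dvd30_six false h30; rewrite mul1r.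
have sqx b : ((-1) ^+ b * q) ^+ 2 = 1 \/ ((-1) ^+ b * q) ^+ 2 = -1 by rewrite sign_sqr.
have three b : nonzero q [:: 3; (-1) ^+ b * 1].
  apply/negP; rewrite peval2_sign mul1r; set x := _ * q => /eqP h.
  case: (sqx b) => xx.
    move/eqP: eight_neq0; apply.
    have -> : 8 = (3 + x) * (3 - x) + (x ^+ 2 - 1) by ring.
    by rewrite h xx mul0r subrr addr0.
  have h10 : (10 : 'Z_n) = 0.
    have -> : 10 = (3 + x) * (3 - x) + (x ^+ 2 + 1) by ring.
    by rewrite h xx mul0r addNr addr0.
  apply: contra10 => //; have e6 := q6 h10; rewrite -(sign_sqr b) -/x in e6.
  have -> : 48 = 6 * ((3 + x) * (3 - x)) + (6 * x ^+ 2 - 6) by ring.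
  by rewrite h e6 mul0r mulr0 subrr addr0.
have one b : nonzero q [:: 1; (-1) ^+ b * 3].
  apply/negP; rewrite peval2_sign; set x := _ * q => /eqP h.
  have {}h : 1 + 3 * x = 0 := h.
  case: (sqx b); rewrite -/x => xx.
    move/eqP: eight_neq0; apply.
    have -> : 8 = - ((1 + 3 * x) * (1 - 3 * x)) - 9 * (x ^+ 2 - 1) by ring.
    by rewrite h xx mul0r (subrr 1) mulr0 oppr0 addr0.
  have h10 : (10 : 'Z_n) = 0.
    have -> : 10 = (1 + 3 * x) * (1 - 3 * x) + 9 * (x ^+ 2 + 1) by ring.
    by rewrite h xx mul0r addNr mulr0 addr0.
  apply: contra10 => //; have e6 := q6 h10; rewrite -(sign_sqr b) -/x in e6.
  have -> : 48 = - 6 * ((1 + 3 * x) * (1 - 3 * x)) - 9 * (6 * x ^+ 2 - 6) by ring.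
  by rewrite h e6 mul0r (subrr 6) !mulr0 subr0.
by rewrite !all_cons (three false) (three true) (one false) (one true).
Qed.

End GenericSquare.
End Arithmetic.

Definition sign_pairs : seq (bool * bool) :=
  [:: (false, false); (false, true); (true, false); (true, true)].
(* When m = 4, the octagons that climb through all the layers close exactly when
   one of the forms 1 +- q +- q^2 +- q^3 vanishes; when m = 3, the corresponding
   hexagons need a form 1 +- q +- q^2. *)
Definition quads (b : bool) : seq (seq int) :=
  [seq [:: 1; (-1) ^+ b; (-1) ^+ c.1; (-1) ^+ c.2] | c : bool * bool <- sign_pairs].
Definition triples : seq (seq int) :=
  [seq [:: 1; (-1) ^+ c.1; (-1) ^+ c.2] | c : bool * bool <- sign_pairs].

Fixpoint reduce2 (e : int) (P : seq int) : int * int :=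
  if P is c :: P' then let ab := reduce2 e P' in (c + e * ab.2, ab.1) else (0, 0).

Lemma peval_reduce2 (R : comNzRingType) (t : R) (e : int) P : t ^+ 2 = e%:~R ->
  peval t P = (reduce2 e P).1%:~R + t * (reduce2 e P).2%:~R.
Proof.
move=> te; elim: P => [|c P /= ->]; first by rewrite mulr0 addr0.
rewrite rmorphD rmorphM /= -te; ring.
Qed.

Definition reduced_in (K : seq (seq int)) (e : int) (P : seq int) : bool :=
  up_to_sign K [:: (reduce2 e P).1; (reduce2 e P).2].
Definition reduced_zero (e : int) (P : seq int) : bool := reduce2 e P == (0, 0).

Lemma sign_of_pm1 (R : pzRingType) (x : R) : x = 1 \/ x = -1 -> exists b : bool, x = (-1) ^+ b.
Proof. by case=> ->; [exists false|exists true]. Qed.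

Lemma signz_intr (R : pzRingType) (b : bool) : ((-1) ^+ b : int)%:~R = (-1) ^+ b :> R.
Proof. by rewrite rmorphXn rmorphN1. Qed.

Section Quads34.
Variables (n : nat).
Hypothesis n_ge3 : (3 <= n)%N.
Let n_gt1 : (1 < n)%N. Proof. exact: ltnW. Qed.

(** After doubling, y may be replaced by -2. The resulting v is odd of absolute value at most 15, so
    gcd(2v, 34) = 2 and n would divide 2. *)
Lemma quad34 (y : 'Z_n) (a b c d : bool) : 4 + 2 * y = 0 -> (34 : 'Z_n) = 0 ->
  (-1) ^+ a + (-1) ^+ b * y + (-1) ^+ c * y ^+ 2 + (-1) ^+ d * y ^+ 3 != 0.
Proof.
move=> h1 h34; apply/eqP => h.
pose v : int := (-1) ^+ a - 2 * (-1) ^+ b + 4 * (-1) ^+ c - 8 * (-1) ^+ d.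
have : (2 * v)%:~R = 0 :> 'Z_n.
  rewrite /v; transitivity (2 * ((-1) ^+ a - 2 * (-1) ^+ b + 4 * (-1) ^+ c - 8 * (-1) ^+ d) : 'Z_n).
    by rewrite !(rmorphM, rmorphD, rmorphN, rmorphXn, rmorphN1).
  move: h; set A := (-1) ^+ a; set B := (-1) ^+ b; set C := (-1) ^+ c; set E := (-1) ^+ d => h.
  have -> : 2 * (A - 2 * B + 4 * C - 8 * E) =
    2 * (A + B * y + C * y ^+ 2 + E * y ^+ 3) -
    (4 + 2 * y) * (B + C * (y - 2) + E * (y ^+ 2 - 2 * y + 4)) by ring.
  by rewrite h h1 mulr0 mul0r subr0.
move/eqP; rewrite Zn_int_eq0 // => d1.
have d34 : (n %| 34)%N by rewrite -Zn_nat_eq0 // h34.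
have : (n %| gcdn `|(2 * v)%R| 34)%N by rewrite dvdn_gcd d1.
have -> : gcdn `|(2 * v)%R| 34 = 2%N by rewrite /v; case: (a); case: (b); case: (c); case: (d).
by move/(dvdn_leq (isT : (0 < 2)%N)); rewrite leqNgt n_ge3.
Qed.

End Quads34.

Section GenericSquareQuads.
Variables (m n : nat) (r : 'Z_n).
Hypothesis m_gt0 : (0 < m)%N.
Hypothesis n_ge3 : (3 <= n)%N.
Hypothesis n_neq4 : n <> 4%N.
Hypothesis ms_ge3 : (3 <= m * 2)%N.
Hypothesis r_unit : r \is a GRing.unit.
Hypothesis r_ms : r ^+ (m * 2) = 1 \/ r ^+ (m * 2) = -1.
Hypothesis Gamma_2at : two_arc_transitive (CPM m 2 n r).
Let n_gt1 : (1 < n)%N. Proof. exact: ltnW. Qed.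
Local Notation q := (r ^+ 2).
Hypothesis q2p : nonzero q [:: 2; 2].
Hypothesis q2m : nonzero q [:: 2; -2].

Let gen_nz : all (nonzero q) generic_forms := generic_forms_nonzero n_ge3 n_neq4 r_unit q2p q2m.

Lemma q_pow_m : q ^+ m = 1 \/ q ^+ m = -1.
Proof. by rewrite -exprM mulnC. Qed.

(** 4 + 2x = 0 and x^4 = 1 or -1 give 30 = 0, already excluded, or 34 = 0. If 2 + 4x = 0 instead,
    the inverse of x satisfies the former equation, and passing to it reverses the coefficients of
    the form. *)
Lemma quads_nonzero b : vanishing q (four_two b) \/ vanishing q (two_four b) ->
  q ^+ 4 = 1 \/ q ^+ 4 = -1 -> all (nonzero q) (quads false ++ quads true).
Proof.
move=> hS q4; have q_unit : q \is a GRing.unit by apply: unitrX.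
have sign_unit (c : bool) : (-1) ^+ c \is a @GRing.unit 'Z_n by rewrite unitrX ?unitrN1.
pose x := (-1) ^+ b * q; have x4 : x ^+ 4 = 1 \/ x ^+ 4 = -1.
  by rewrite (exprM x 2 2) /x sign_sqr -(exprM q 2 2).
suff quadP (c d e : bool) : 1 + (-1) ^+ c * q + (-1) ^+ d * q ^+ 2 + (-1) ^+ e * q ^+ 3 != 0.
  apply/allP => P; rewrite mem_cat => /orP[] /mapP[c _ ->];
    rewrite /nonzero /= !signz_intr mulr0 addr0;
    have := quadP; [move/(_ false c.1 c.2)|move/(_ true c.1 c.2)];
    rewrite ?expr0 ?expr1; congr (_ != 0); ring.
have eq_x : q = (-1) ^+ b * x by rewrite /x mulrA -signr_addb addbb mul1r.
have quad_x : 1 + (-1) ^+ c * q + (-1) ^+ d * q ^+ 2 + (-1) ^+ e * q ^+ 3 =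
    (-1) ^+ false + (-1) ^+ (c (+) b) * x + (-1) ^+ d * x ^+ 2 + (-1) ^+ (e (+) b) * x ^+ 3.
  rewrite eq_x !signr_addb !exprMn sqrr_sign mul1r [(_ ^+ b) ^+ 3]exprS sqrr_sign.
  by ring.
rewrite quad_x; case: hS => [hS|hS].
  have h := hS; move: h; rewrite /vanishing peval2_sign => /eqP h.
  have [h30|h34] := four_two_pow4 x4 h; last exact: quad34.
  by have := four_two_dvd30 n_ge3 r_unit q2m hS h30.
have h := hS; move: h; rewrite /vanishing peval2_sign -/x => /eqP h.
have x_unit : x \is a GRing.unit by rewrite unitrM sign_unit.
have h' : 4 + 2 * x^-1 = 0.
  have -> : 4 + 2 * x^-1 = x^-1 * (2 + 4 * x) by rewrite mulrDr [x^-1 * (4 * x)]mulrC -mulrA divrr // mulr1 addrC mulrC.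
  by rewrite h mulr0.
have y4 : x^-1 ^+ 4 = 1 \/ x^-1 ^+ 4 = -1.
  by rewrite exprVn; case: x4 => ->; [left; rewrite invr1|right; rewrite invrN1].
have [h30|h34] := four_two_pow4 y4 h'.
  by have := two_four_dvd30 n_ge3 r_unit q2m hS h30.
have := quad34 n_ge3 (e (+) b) d (c (+) b) false h' h34.
apply: contra => /eqP h0; apply/eqP.
transitivity (x^-1 ^+ 3 * ((-1) ^+ false + (-1) ^+ (c (+) b) * x + (-1) ^+ d * x ^+ 2 + (-1) ^+ (e (+) b) * x ^+ 3)).
  have xV : x^-1 * x = 1 by rewrite mulVr.
  move: xV; set y := x^-1 => xV.
  set A := (-1) ^+ false; set B := (-1) ^+ (c (+) b); set C := (-1) ^+ d; set E := (-1) ^+ (e (+) b).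
  have -> : y ^+ 3 * (A + B * x + C * x ^+ 2 + E * x ^+ 3) =
    A * y ^+ 3 + B * y ^+ 2 * (y * x) + C * y * (y * x) ^+ 2 + E * (y * x) ^+ 3 by ring.
  rewrite xV; ring.
by rewrite h0 mulr0.
Qed.

End GenericSquareQuads.

(** * Octagon counts for two directions and a generic square *)

Definition special_forms : seq (seq int) :=
  [:: four_two false; four_two true; two_four false; two_four true].

Section GenericSquareCounts.
Variables (m n : nat) (r : 'Z_n).
Hypothesis m_gt0 : (0 < m)%N.
Hypothesis n_ge3 : (3 <= n)%N.
Hypothesis n_neq4 : n <> 4%N.
Hypothesis ms_ge3 : (3 <= m * 2)%N.
Hypothesis r_unit : r \is a GRing.unit.
Hypothesis r_ms : r ^+ (m * 2) = 1 \/ r ^+ (m * 2) = -1.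
Hypothesis Gamma_2at : two_arc_transitive (CPM m 2 n r).
Local Notation q := (r ^+ 2).
Hypothesis q2p : nonzero q [:: 2; 2].
Hypothesis q2m : nonzero q [:: 2; -2].

Let gen_nz : all (nonzero q) generic_forms := generic_forms_nonzero n_ge3 n_neq4 r_unit q2p q2m.

Variable S : lifted 2 n.
Hypothesis S_ge9 : (9 <= S.1)%N.
Hypothesis S_root : cov m r S = (0, 0).

Local Notation closed_walks := (@closed_walks m 2 n r).

Lemma net_upp (nl : pred nat) (K : seq (seq int)) L l1 l2 l3 k : (L <= 6)%N ->
  (forall d, nl d -> ~~ (m * 2 %| d)%N) -> all (nonzero q) K ->
  (possible_words nl (some_class 2 (up_to_sign K)) L l1 l2 l3 <= k)%N -> (closed_walks L S l1 l2 l3 <= k)%N.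
Proof.
move=> L_le nlP KP; apply: (class_upp (s := 2%N) n_ge3 ms_ge3 r_unit r_ms isT S_ge9 L_le nlP).
exact: up_to_sign_nonzero.
Qed.

Lemma net_low (zl : pred nat) (K : seq (seq int)) L l1 l2 l3 k : (L <= 6)%N ->
  (forall d, zl d -> (m * 2 %| d)%N) -> all (vanishing q) K ->
  (k <= sure_words zl (every_class 2 (trim_or_up_to_sign K)) L l1 l2 l3)%N ->
  (k <= closed_walks L S l1 l2 l3)%N.
Proof.
move=> L_le zlP KP; apply: (class_low (s := 2%N) n_ge3 ms_ge3 r_unit r_ms isT S_ge9 L_le zlP).
exact: up_to_sign_vanishing.
Qed.

Lemma turn_pos b : (0 < closed_walks 6 S (U false) (D false) (D b))%N.
Proof.
by apply: (net_low (L := 6%N) (K := [::]) isT (@dvdn_of_eq0 (m * 2))) => //; case: b; vm_compute.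
Qed.

Lemma straight_turn_pos : (0 < closed_walks 6 S (U false) (U false) (D false))%N.
Proof. by apply: (net_low (L := 6%N) (K := [::]) isT (@dvdn_of_eq0 (m * 2))) => //; vm_compute. Qed.

Let ts := turn_straight n_ge3 ms_ge3 r_unit r_ms Gamma_2at S_ge9 S_root.

Lemma turn_all_pos_contra c :
  (0 < closed_walks 6 S (U false) (D false) (U false))%N ->
  closed_walks 6 S (U false) (U false) (U c) = 0%N -> False.
Proof.
move=> h1 h2; apply: (count_contra1 (ts (pred1 0%N) 6)).
- by rewrite [pred1 _ _]eqn0Ngt h1.
- by rewrite [pred1 _ _]eqn0Ngt turn_pos.
- by rewrite [pred1 _ _]eqn0Ngt turn_pos.
- by case: c h2 => ->; rewrite ?orbT.
Qed.

Lemma straight_zero_contra :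
  (forall b, closed_walks 6 S (U false) (U false) (U b) = 0%N) -> False.
Proof.
move=> z; apply: (count_contra2 (ts (pred1 0%N) 6)).
- by rewrite [pred1 _ _]eqn0Ngt turn_pos.
- by rewrite [pred1 _ _]eqn0Ngt turn_pos.
- by rewrite z.
- by rewrite z.
Qed.

(** Read cyclically, the sporadic octagon contains up-down-up: its final up-down is followed by its
    initial up. *)
Lemma four_two_turn b : vanishing q (four_two b) || vanishing q (two_four b) ->
  (0 < closed_walks 6 S (U false) (D false) (U false))%N.
Proof.
case/orP=> h.
  apply: (net_low (L := 6%N) (K := [:: four_two b]) isT (@dvdn_of_eq0 (m * 2))).
    by rewrite all_cons h.
  by case: (b); vm_compute.
apply: (net_low (L := 6%N) (K := [:: two_four b]) isT (@dvdn_of_eq0 (m * 2))).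
  by rewrite all_cons h.
by case: (b); vm_compute.
Qed.

Definition special_complements (b : bool) : seq (seq (seq int)) :=
  [:: [:: four_two (~~ b); two_four false; two_four true];
      [:: two_four (~~ b); four_two false; four_two true]].

(** Without sporadic octagons up-up-up lies on none at all. With those of sign b, all three
    extensions of up-down lie on octagons, but up-up-up with relative sign [~~ b] does not. *)
Lemma special_contra (nl : pred nat) (K : seq (seq int)) :
  (forall d, nl d -> ~~ (m * 2 %| d)%N) -> all (nonzero q) K ->
  (forall b, possible_words nl (some_class 2 (up_to_sign (generic_forms ++ special_forms ++ K)))
     6 (U false) (U false) (U b) <= 0)%N ->
  (forall b C, C \in special_complements b ->
     possible_words nl (some_class 2 (up_to_sign (generic_forms ++ C ++ K)))
     6 (U false) (U false) (U (~~ b)) <= 0)%N -> False.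
Proof.
move=> nlP KP h1 h2.
have [nz|[b h nz]|[b h nz]] := special_cases n_ge3 n_neq4 r_unit q2m.
- apply: straight_zero_contra => b; apply/eqP; rewrite -leqn0.
  by apply: net_upp nlP _ (h1 b) => //; rewrite !all_cat gen_nz KP [all _ special_forms]nz.
- apply: (turn_all_pos_contra (c := ~~ b)); first by apply: (four_two_turn (b := b)); rewrite h.
  apply/eqP; rewrite -leqn0; apply: net_upp nlP _ (h2 b _ (mem_head _ _)) => //.
  by rewrite !all_cat gen_nz KP nz.
- apply: (turn_all_pos_contra (c := ~~ b)); first by apply: (four_two_turn (b := b)); rewrite h orbT.
  apply/eqP; rewrite -leqn0; apply: net_upp nlP _ (h2 b _ (mem_last _ [:: _])) => //.
  by rewrite !all_cat gen_nz KP nz.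
Qed.

(** An octagon changes the layer by at most 8 < 2m, so none wraps around. *)
Lemma m_lt5 : (m < 5)%N.
Proof.
rewrite ltnNge; apply/negP => m_ge5.
apply: (@special_contra (fun d => odd d || (d \in [:: 2; 4; 6; 8]%N)) [::]) => //.
- move=> d /orP[d_odd|].
    by apply/negP => /(dvdn_trans (dvdn_mull m (dvdnn 2))); rewrite dvdn2 d_odd.
  by rewrite !inE => /or4P[] /eqP->; apply/negP => /dvdn_leq; lia.
- by case; vm_compute.
- by case=> C; rewrite !inE => /orP[] /eqP->; vm_compute.
Qed.

(** Six steps up now wrap around. If a form in [triples] vanishes, some hexagon contains up-up-up,
    whereas none contains up-down; otherwise the octagons decide as for larger m. *)
Lemma m_neq3 : m <> 3%N.
Proof.
move=> m3; have [q3 q3E] : exists b : bool, q ^+ 3 = (-1) ^+ b.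
  by apply: sign_of_pm1; move: (q_pow_m r_ms); rewrite m3.
pose nl d := ~~ (6 %| d)%N.
have nlP d : nl d -> ~~ (m * 2 %| d)%N by rewrite m3.
have [KP|/allPn[P P_in]] := boolP (all (nonzero q) triples).
  apply: (@special_contra nl triples nlP KP); first by case; vm_compute.
  by case=> C; rewrite !inE => /orP[] /eqP->; vm_compute.
rewrite negbK => PV; have {}PV : vanishing q P := PV.
have turn0 l : l \in [:: U false; D false; D true] ->
    closed_walks 4 S (U false) (D false) l = 0%N.
  move=> l_in; apply/eqP; rewrite -leqn0.
  apply: (net_upp (K := generic_forms ++ [:: [:: 6]]) (L := 4%N) isT nlP).
    rewrite all_cat gen_nz all_cons /nonzero peval1 andbT.
    exact: (six_neq0 n_ge3 r_unit q2m).
  by move: l_in; rewrite !inE => /or3P[] /eqP->; vm_compute.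
have straight : exists c, (0 < closed_walks 4 S (U false) (U false) (U c))%N.
  have [c cE] : exists c : bool * bool, P = [:: 1; (-1) ^+ c.1; (-1) ^+ c.2].
    by have /mapP[c _ ->] := P_in; exists c.
  (* The same relation read two layers higher: q P' = P because [q ^+ 3] is the sign [q3]. It
     certifies the return to the initial dart, not only to the initial vertex. *)
  pose P' : seq int := [:: (-1) ^+ c.1; (-1) ^+ c.2; (-1) ^+ q3].
  have P'V : vanishing q P'.
    rewrite /vanishing -(mulrI_eq0 _ (mulrI (unitrX 2 r_unit))); apply/eqP.
    transitivity (peval q P - 1 + (-1) ^+ q3 * q ^+ 3).
      rewrite cE /P' /= !signz_intr !mulr0 !addr0; ring.
    have /eqP PV0 := PV.
    by rewrite PV0 q3E -expr2 sqrr_sign sub0r addNr.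
  exists (c.1 && ~~ c.2).
  apply: (net_low (K := [:: P; P']) (L := 4%N) isT (zl := fun d => (6 %| d)%N)).
  - by move=> d; rewrite m3.
  - by rewrite !all_cons PV P'V.
  - by rewrite cE /P'; case: (c) => [[] []]; case: (q3); vm_compute.
case: straight => c c_gt0; apply: (count_contra3 (ts (pred1 0%N) 4)).
- by rewrite turn0 ?inE.
- by rewrite turn0 ?inE.
- by rewrite turn0 ?inE.
- apply/nandP; case: c c_gt0 => h; [right|left]; by rewrite [pred1 _ _]eqn0Ngt h.
Qed.

(** As q^2 is 1 or -1, the four layers met in one direction during eight steps up can cancel in
    pairs. So every extension of up-up lies on an octagon, while up-down-up lies on none. *)
Lemma m_neq2 : m <> 2%N.
Proof.
move=> m2; have qq := q_pow_m r_ms; rewrite m2 in qq.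
have [b bE] := sign_of_pm1 qq.
have qe : q ^+ 2 = ((-1) ^+ b : int)%:~R by rewrite signz_intr.
pose K := generic_forms ++ special_forms ++
  [:: [:: 3; 1]; [:: 3; -1]; [:: 1; 3]; [:: 1; -3]] : seq (seq int).
have KP : all (nonzero q) K.
  rewrite !all_cat gen_nz [all _ special_forms](special_sqr n_ge3 n_neq4 r_unit q2m qq).
  exact: (three_one_nonzero n_ge3 n_neq4 r_unit q2m qq).
have turn0 : closed_walks 6 S (U false) (D false) (U false) = 0%N.
  apply/eqP; rewrite -leqn0.
  apply: (class_upp (s := 2%N) (L := 6%N) n_ge3 ms_ge3 r_unit r_ms isT S_ge9 isT
    (nl := fun d => ~~ (4 %| d)%N) (p := reduced_in K ((-1) ^+ b))).
  - by move=> d; rewrite m2.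
  - move=> P h; rewrite (peval_reduce2 _ qe) -peval2.
    exact: up_to_sign_nonzero h.
  - by case: (b); vm_compute.
have straight l : l \in [:: U false; U true; D false] ->
    (0 < closed_walks 6 S (U false) (U false) l)%N.
  move=> l_in.
  apply: (class_low (s := 2%N) (L := 6%N) n_ge3 ms_ge3 r_unit r_ms isT S_ge9 isT
    (zl := fun d => (4 %| d)%N) (p := reduced_zero ((-1) ^+ b))).
  - by move=> d; rewrite m2.
  - by move=> P /eqP h; rewrite (peval_reduce2 _ qe) h mulr0 addr0.
  - by move: l_in; rewrite !inE => /or3P[] /eqP->; case: (b); vm_compute.
apply: (count_contra4 (ts (pred1 0%N) 6)).
- by rewrite turn0.
- by rewrite [pred1 _ _]eqn0Ngt straight ?inE.
- by rewrite [pred1 _ _]eqn0Ngt straight ?inE.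
- by rewrite [pred1 _ _]eqn0Ngt straight ?inE.
Qed.

Lemma m_eq4 : m = 4%N.
Proof.
have := m_lt5; have := m_neq3; have := m_neq2; move: ms_ge3.
by case: (m) => [|[|[|[|[|]]]]].
Qed.

Lemma quads_low b : has (vanishing q) (quads b) ->
  (0 < closed_walks 6 S (U false) (U false) (U b))%N.
Proof.
move=> /hasP[P P_in PV].
have [q4 q4E] : exists e : bool, q ^+ 4 = (-1) ^+ e.
  by apply: sign_of_pm1; move: (q_pow_m r_ms); rewrite m_eq4.
have [c cE] : exists c : bool * bool, P = [:: 1; (-1) ^+ b; (-1) ^+ c.1; (-1) ^+ c.2].
  by have /mapP[c _ ->] := P_in; exists c.
pose P' : seq int := [:: (-1) ^+ b; (-1) ^+ c.1; (-1) ^+ c.2; (-1) ^+ q4].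
have P'V : vanishing q P'.
  rewrite /vanishing -(mulrI_eq0 _ (mulrI (unitrX 2 r_unit))); apply/eqP.
  transitivity (peval q P - 1 + (-1) ^+ q4 * q ^+ 4).
    rewrite cE /P' /= !signz_intr !mulr0 !addr0; ring.
  have /eqP PV0 := PV.
  by rewrite PV0 q4E -expr2 sqrr_sign sub0r addNr.
apply: (net_low (K := [:: P; P']) (L := 6%N) isT (zl := fun d => (8 %| d)%N)).
- by move=> d; rewrite m_eq4.
- by rewrite !all_cons PV P'V.
- by rewrite cE /P'; case: (c) => [[] []]; case: (q4); case: (b); vm_compute.
Qed.

(** Once the sporadic forms are excluded, up-down-up is the only extension of up-down off the
    octagons. As up-up-down lies on the commutator, exactly one sign of up-up-up must lie on
    octagons. *)
Lemma m4_quads : all (nonzero q) special_forms /\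
  has (vanishing q) (quads false) (+) has (vanishing q) (quads true).
Proof.
have nlP d : ~~ (8 %| d)%N -> ~~ (m * 2 %| d)%N by rewrite m_eq4.
have q4 : q ^+ 4 = 1 \/ q ^+ 4 = -1 by move: (q_pow_m r_ms); rewrite m_eq4.
have hasn b : has (vanishing q) (quads b) = ~~ all (nonzero q) (quads b).
  by rewrite -has_predC; apply: eq_has => P; rewrite /= negbK.
have special_all : all (nonzero q) special_forms.
  have [//|[b h nz]|[b h nz]] := special_cases n_ge3 n_neq4 r_unit q2m; exfalso.
  - have KP := quads_nonzero n_ge3 r_unit q2m (or_introl h) q4.
    apply: (turn_all_pos_contra (c := ~~ b)); first by apply: (four_two_turn (b := b)); rewrite h.
    apply/eqP; rewrite -leqn0.
    apply: (net_upp (L := 6%N) (K := generic_forms ++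
      [:: four_two (~~ b); two_four false; two_four true] ++
      (quads false ++ quads true)) isT nlP).
      by rewrite !all_cat gen_nz nz -all_cat.
    by case: (b); vm_compute.
  - have KP := quads_nonzero n_ge3 r_unit q2m (or_intror h) q4.
    apply: (turn_all_pos_contra (c := ~~ b)); first by apply: (four_two_turn (b := b)); rewrite h orbT.
    apply/eqP; rewrite -leqn0.
    apply: (net_upp (L := 6%N) (K := generic_forms ++
      [:: two_four (~~ b); four_two false; four_two true] ++
      (quads false ++ quads true)) isT nlP).
      by rewrite !all_cat gen_nz nz -all_cat.
    by case: (b); vm_compute.
split=> //.
have turn0 : closed_walks 6 S (U false) (D false) (U false) = 0%N.
  apply/eqP; rewrite -leqn0.
  apply: (net_upp (L := 6%N) (K := generic_forms ++ special_forms) isT nlP).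
    by rewrite all_cat gen_nz.
  by vm_compute.
have straight0 b : all (nonzero q) (quads b) -> closed_walks 6 S (U false) (U false) (U b) = 0%N.
  move=> KP; apply/eqP; rewrite -leqn0.
  apply: (net_upp (L := 6%N) (K := generic_forms ++ special_forms ++ quads b) isT nlP).
    by rewrite !all_cat gen_nz special_all.
  by case: (b) {KP}; vm_compute.
have [h1|h1] := boolP (has _ (quads false)); have [h2|h2] := boolP (has _ (quads true)) => //.
- exfalso; apply: (count_contra4 (ts (pred1 0%N) 6)).
  + by rewrite turn0.
  + by rewrite [pred1 _ _]eqn0Ngt quads_low.
  + by rewrite [pred1 _ _]eqn0Ngt quads_low.
  + by rewrite [pred1 _ _]eqn0Ngt straight_turn_pos.
- exfalso; apply: straight_zero_contra => -[]; apply: straight0.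
    by move: h2; rewrite hasn negbK.
  by move: h1; rewrite hasn negbK.
Qed.

End GenericSquareCounts.

(** * Zigzags of turning and straight 2-arcs *)

Section Zigzag.
Variables (m s n : nat) (r : 'Z_n).
Hypothesis n_ge3 : (3 <= n)%N.
Hypothesis ms_ge3 : (3 <= m * s)%N.
Hypothesis r_unit : r \is a GRing.unit.
Hypothesis r_ms : r ^+ (m * s) = 1 \/ r ^+ (m * s) = -1.
Let n_gt1 : (1 < n)%N. Proof. exact: ltnW. Qed.

Local Notation cov := (@cov m s n r).
Local Notation step := (@step s n r).
Local Notation closed_walks := (@closed_walks m s n r).

(* l3 is the only way to prolong the 2-arc with letters l1, l2 to a 3-arc off all
   closed walks of length L + 2. *)
Definition only_extension L (S : lifted s n) l1 l2 l3 : Prop :=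
  l3 != letter_inv l2 /\
  forall l, l != letter_inv l2 -> (closed_walks L S l1 l2 l == 0%N) = (l == l3).

Lemma only_extensionP L (S : lifted s n) l1 l2 l3 : (2 < S.1)%N ->
  only_extension L S l1 l2 l3 ->
  forall w, [&& sedge (cov (step (step S l1) l2)) w, w != cov (step S l1) &
    nb_walks L (cov (step (step S l1) l2)) w (cov S) (cov (step S l1)) == 0%N] =
    (w == cov (step (step (step S l1) l2) l3)).
Proof.
move=> S_gt2 [l3_ok only] w.
have S1_gt1 : (1 < (step S l1).1)%N.
  by rewrite /step; case: l1.1 => //=; case: (S.1) S_gt2 => [|[|]].
have S1_gt0 : (0 < (step S l1).1)%N by apply: ltnW.
have S2_gt0 : (0 < (step (step S l1) l2).1)%N.
  by rewrite {1}/step; case: l2.1 => //=; case: ((step S l1).1) S1_gt1 => [|[|]].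
have inj := cov_step_inj n_ge3 ms_ge3 r_unit S2_gt0.
have back : cov (step S l1) = cov (step (step (step S l1) l2) (letter_inv l2)).
  by rewrite step_inv.
rewrite (cov_nbr ms_ge3 r_ms _ S2_gt0).
apply/idP/eqP => [/and3P[/mapP[l _ ->] ne z]|->].
  have l_ok : l != letter_inv l2 by apply: contraNneq ne => ->; rewrite -back.
  by have := only l l_ok; rewrite z => /esym/eqP->.
apply/and3P; split.
- by apply/mapP; exists l3 => //; case: l3 {l3_ok only} => [[] []].
- by rewrite back (inj_eq inj).
- by rewrite -[nb_walks _ _ _ _ _]/(closed_walks L S l1 l2 l3) only.
Qed.

Lemma zigzag_path L (pos : nat -> lifted s n) (l : nat -> letter) k x y z :
  (forall i, step (pos i) (l i) = pos i.+1) -> (forall i, 2 < (pos i).1)%N ->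
  (forall i, only_extension L (pos i) (l i) (l i.+1) (l i.+2)) ->
  zigzag L k (cov (pos 0%N)) (cov (pos 1%N)) (cov (pos 2%N)) x y z =
  [&& cov (pos k) == x, cov (pos k.+1) == y & cov (pos k.+2) == z].
Proof.
move=> posS pos_gt only; apply: (@zigzagE _ L (fun i => cov (pos i)) k x y z) => i w.
have := only_extensionP (pos_gt i) (only i) w.
by rewrite !posS.
Qed.

Section Turn.
Variable L : nat.
Hypothesis peak : forall S : lifted s n, (9 <= S.1)%N ->
  only_extension L S (U false) (D false) (U false).
Hypothesis valley : forall S : lifted s n, (9 <= S.1)%N ->
  only_extension L S (D false) (U false) (D false).
Variable S : lifted s n.
Hypothesis S_ge9 : (9 <= S.1)%N.

(** Every step, up or down, adds the same vector [gen S.1], which has order n, and the layer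
    alternates between two values. *)
Lemma zigzag_turn k :
  let S1 := step S (U false) in let S2 := step S1 (D false) in
  zigzag L k (cov S) (cov S1) (cov S2) (cov S) (cov S1) (cov S2) =
  (2 %| k)%N && (n %| k)%N.
Proof.
pose pos i : lifted s n := ((S.1 + odd i)%N, S.2 + i%:R *: gen s r S.1).
have pos0 : pos 0%N = S by rewrite /pos addn0 scale0r addr0; case: (S).
have posS i : step (pos i) (~~ odd i, false) = pos i.+1.
  rewrite /step /pos oddS; case: (odd i); rewrite ![_.1]/= ![_.2]/= ?addn0 ?addn1;
    by rewrite scale1r -addrA -[i.+1]addn1 natrD scalerDl scale1r.
have pos_ge i : (9 <= (pos i).1)%N by apply: leq_trans (leq_addr _ _).
have only i : only_extension L (pos i) (~~ odd i, false) (~~ odd i.+1, false) (~~ odd i.+2, false).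
  by have := peak (pos_ge i); have := valley (pos_ge i); rewrite !oddS; case: (odd i).
move=> S1 S2; have S1E : S1 = pos 1%N by rewrite -(posS 0%N) pos0.
have S2E : S2 = pos 2%N by rewrite -(posS 1%N) -S1E.
rewrite S2E S1E -{1 2}pos0.
rewrite (zigzag_path (l := fun i => (~~ odd i, false)) _ _ _ _ posS _ only); last first.
  by move=> i; apply: leq_trans (pos_ge i).
have n0 i : (i%:R *: gen s r S.1 == 0) = (n %| i)%N.
  rewrite -(Zn_nat_eq0 i n_gt1); apply/eqP/eqP => [|->]; last by rewrite scale0r.
  have s_gt0 : (0 < s)%N by case: (s) ms_ge3 => //; rewrite muln0.
  move=> /rowP/(_ (Ordinal (ltn_pmod S.1 s_gt0))); rewrite !mxE eqxx mulr1 => h.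
  by rewrite -(mulrK (unitrX S.1 r_unit) i%:R) h mul0r.
have shift i : (n %| k)%N -> pos (k + i)%N = ((S.1 + odd (k + i))%N, (pos i).2).
  by rewrite -n0 => /eqP h; rewrite /pos natrD scalerDl h add0r.
apply/and3P/andP => [[+ _ _]|[k_even k_n]].
  rewrite cov_eq ?(ltnW ms_ge3) // => /andP[h1 h2]; split.
    rewrite dvdn2; apply: contraL h1 => k_odd.
    rewrite -[(pos k).1]/(S.1 + odd k)%N -[(pos 0%N).1]/(S.1 + 0)%N k_odd.
    rewrite eqn_modDl mod0n modn_small //; exact: ltnW.
  move: h2; rewrite -[(pos k).2]/(S.2 + k%:R *: gen s r S.1).
  by rewrite -[(pos 0%N).2]/(S.2 + 0%:R *: gen s r S.1) (inj_eq (addrI _)) scale0r n0.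
have e i : pos (k + i)%N = pos i.
  by rewrite shift // oddD -[odd k]negbK -dvdn2 k_even.
by rewrite -[k]addn0 -!addnS !e.
Qed.

End Turn.

Section Straight.
Variables (L : nat) (tau : bool).
Hypothesis straight : forall (S : lifted s n) a b, (9 <= S.1)%N ->
  only_extension L S (U a) (U b) (U (a (+) tau)).
Variable S : lifted s n.
Hypothesis S_ge9 : (9 <= S.1)%N.

(** Each sign is that of two steps before, changed when [tau] holds. Starting from two plus signs,
    this is the period 4 pattern with exponent [tau && odd i./2]. *)
Lemma zigzag_straight k :
  let S1 := step S (U false) in let S2 := step S1 (U false) in
  zigzag L k (cov S) (cov S1) (cov S2) (cov S) (cov S1) (cov S2) ->
  (m * s %| k)%N /\
  \sum_(i < k) (-1) ^+ (tau && odd i./2) *: gen s r (S.1 + i) = 0.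
Proof.
pose l i : letter := (true, tau && odd i./2).
pose pos i : lifted s n := ((S.1 + i)%N,
  S.2 + \sum_(i < i) (-1) ^+ (tau && odd i./2) *: gen s r (S.1 + i)).
have pos0 : pos 0%N = S by rewrite /pos addn0 big_ord0 addr0; case: (S).
have posS i : step (pos i) (l i) = pos i.+1.
  by rewrite /step /pos big_ord_recr /= addnS addrA.
have pos_ge i : (9 <= (pos i).1)%N by apply: leq_trans (leq_addr _ _).
have only i : only_extension L (pos i) (l i) (l i.+1) (l i.+2).
  have := straight (l i).2 (l i.+1).2 (pos_ge i).
  by rewrite /l [_.2]/= [_.2]/= /=; case: tau; case: (odd i./2).
move=> S1 S2; have S1E : S1 = pos 1%N by rewrite -(posS 0%N) pos0 /l andbF.
have S2E : S2 = pos 2%N by rewrite -(posS 1%N) -S1E /l andbF.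
rewrite S2E S1E -{1 2}pos0 (zigzag_path (l := l) _ _ _ _ posS _ only); last first.
  by move=> i; apply: leq_trans (pos_ge i).
case/and3P=> + _ _; rewrite cov_eq ?(ltnW ms_ge3) // => /andP[h1 h2]; split.
  move: h1; rewrite /pos ![(_, _).1]/= eqn_modDl mod0n.
  by [].
by apply/eqP; move: h2; rewrite /pos ![(_, _).2]/= (inj_eq (addrI _)) big_ord0.
Qed.

End Straight.
End Zigzag.

Lemma only_extension_intro m s n (r : 'Z_n) L (S : lifted s n) l1 l2 l3 :
  l3 != letter_inv l2 -> closed_walks m r L S l1 l2 l3 = 0%N ->
  (forall l, l != letter_inv l2 -> l != l3 -> (0 < closed_walks m r L S l1 l2 l)%N) ->
  only_extension m r L S l1 l2 l3.
Proof.
move=> l3_ok z pos; split=> // l l_ok; case: (eqVneq l l3) => [->|ne]; first by rewrite z.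
by rewrite eqn0Ngt pos.
Qed.

(** Only terms of even index lie in the direction of layer j; index 2i contributes [r ^+ j] times
    the i-th power of the signed square. *)
Lemma straight_coord n (r : 'Z_n) (j h : nat) (tau : bool) :
  r \is a GRing.unit ->
  \sum_(i < h.*2) (-1) ^+ (tau && odd i./2) *: gen 2 r (j + i) = 0 ->
  \sum_(i < h) ((-1) ^+ tau * r ^+ 2) ^+ i = 0.
Proof.
move=> r_unit /rowP/(_ (Ordinal (ltn_pmod j (isT : (0 < 2)%N)))); rewrite mxE.
suff -> : (\sum_(i < h.*2) (-1) ^+ (tau && odd i./2) *: gen 2 r (j + i)) 0
    (Ordinal (ltn_pmod j (isT : (0 < 2)%N))) =
    r ^+ j * \sum_(i < h) ((-1) ^+ tau * r ^+ 2) ^+ i.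
  by move=> e; rewrite -(mulKr (unitrX j r_unit) (\sum_(i < h) _)) e mulr0.
rewrite summxE; elim: h => [|h IHh]; first by rewrite !big_ord0 mulr0.
rewrite doubleS !big_ord_recr /= IHh mulrDr -addrA; congr (_ + _).
have e1 : (j %% 2 == (j + h.*2) %% 2)%N by rewrite !modn2 oddD odd_double addbF.
have e2 : (j %% 2 == (j + h.*2.+1) %% 2)%N = false.
  by rewrite !modn2 oddD /= odd_double addbT; case: (odd j).
rewrite !mxE /= e1 e2 doubleK !mulr1 !mulr0 addr0.
rewrite exprD -mul2n exprM mulrCA; congr (_ * _).
rewrite [RHS]exprMn; congr (_ * _).
by case: tau {IHh}; rewrite /= ?expr1n // expr1 signr_odd.
Qed.

Lemma sum_expr_period4 (R : comNzRingType) (y : R) k : y ^+ 4 = 1 ->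
  \sum_(i < k * 4) y ^+ i = k%:R * (1 + y + y ^+ 2 + y ^+ 3).
Proof.
move=> y4; elim: k => [|k IHk]; first by rewrite big_ord0 mul0r.
rewrite mulSn addnC !addnS addn0 !big_ord_recr /= IHk.
have yk : y ^+ (k * 4) = 1 by rewrite mulnC exprM y4 expr1n.
by rewrite !exprS yk -natr1; ring.
Qed.

Section ReturnAtRoot.
Variables (m n : nat) (r : 'Z_n).
Hypothesis n_ge3 : (3 <= n)%N.
Hypothesis ms_ge3 : (3 <= m * 2)%N.
Hypothesis r_unit : r \is a GRing.unit.
Hypothesis r_ms : r ^+ (m * 2) = 1 \/ r ^+ (m * 2) = -1.
Hypothesis Gamma_2at : two_arc_transitive (CPM m 2 n r).
Variables (L : nat) (tau : bool).
Hypothesis peak : forall S : lifted 2 n, (9 <= S.1)%N ->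
  only_extension m r L S (U false) (D false) (U false).
Hypothesis valley : forall S : lifted 2 n, (9 <= S.1)%N ->
  only_extension m r L S (D false) (U false) (D false).
Hypothesis straight : forall (S : lifted 2 n) a b, (9 <= S.1)%N ->
  only_extension m r L S (U a) (U b) (U (a (+) tau)).

(** After 2h steps the turning zigzag is back at its start, hence so is the straight one. *)
Lemma return_straight h : (n %| h.*2)%N ->
  (m * 2 %| h.*2)%N /\ \sum_(i < h) ((-1) ^+ tau * r ^+ 2) ^+ i = 0.
Proof.
move=> n_dvd; have [S S_ge S_root] := root_lift r ms_ge3.
have S_gt2 : (2 < S.1)%N by apply: leq_trans S_ge.
have conn : connect (@sedge (CPMbar m 2 r)) (0, 0) (cov m r S).
  by rewrite S_root connect0.
have arc l2 : l2 != letter_inv (U false) ->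
    two_arc (cov m r S, cov m r (step r S (U false)),
             cov m r (step r (step r S (U false)) l2)).
  by move=> ne; apply: two_arc_cov => //; apply: ltnW.
have := two_arc_transitive_zigzag Gamma_2at (arc (D false) isT)
  (arc (U false) isT) conn conn L h.*2.
have turn := zigzag_turn n_ge3 ms_ge3 r_unit r_ms peak valley S_ge h.*2.
move=> e; have {}e := etrans (esym e) turn.
rewrite n_dvd -mul2n dvdn_mulr // in e.
have [] := zigzag_straight n_ge3 ms_ge3 r_unit r_ms straight S_ge e.
by rewrite mul2n => d sum0; split=> //; apply: straight_coord sum0.
Qed.

End ReturnAtRoot.

Section GenericSquareExcluded.
Variables (m n : nat) (r : 'Z_n).
Hypothesis m_gt0 : (0 < m)%N.
Hypothesis n_ge3 : (3 <= n)%N.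
Hypothesis n_neq4 : n <> 4%N.
Hypothesis ms_ge3 : (3 <= m * 2)%N.
Hypothesis r_unit : r \is a GRing.unit.
Hypothesis r_ms : r ^+ (m * 2) = 1 \/ r ^+ (m * 2) = -1.
Hypothesis Gamma_2at : two_arc_transitive (CPM m 2 n r).
Local Notation q := (r ^+ 2).
Hypothesis q2p : nonzero q [:: 2; 2].
Hypothesis q2m : nonzero q [:: 2; -2].
Let n_gt1 : (1 < n)%N. Proof. exact: ltnW. Qed.

Lemma generic_square_excluded : False.
Proof.
have [S0 S0_ge S0_root] := root_lift r ms_ge3.
have gen_nz := generic_forms_nonzero n_ge3 n_neq4 r_unit q2p q2m.
have m4 : m = 4%N by exact: (m_eq4 m_gt0 n_ge3 n_neq4 ms_ge3 r_unit r_ms Gamma_2at q2p q2m S0_ge S0_root).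
have [special_nz N_xor] := m4_quads m_gt0 n_ge3 n_neq4 ms_ge3 r_unit r_ms Gamma_2at q2p q2m S0_ge S0_root.
(* [tau] is the relative sign with which up-up-up stays off the octagons. *)
have [tau [good bad]] : exists tau, has (vanishing q) (quads (~~ tau)) /\ all (nonzero q) (quads tau).
  have hasn b : ~~ has (vanishing q) (quads b) -> all (nonzero q) (quads b).
    by rewrite -all_predC; apply: sub_all => P; rewrite /= /nonzero /vanishing.
  case: (boolP (has _ (quads false))) N_xor => /= [h1|h1] h2.
    by exists true; split=> //; apply: hasn.
  by exists false; split=> //; apply: hasn.
have nlP d : ~~ (8 %| d)%N -> ~~ (m * 2 %| d)%N by rewrite m4.
have zlP d : (8 %| d)%N -> (m * 2 %| d)%N by rewrite m4.
pose K := generic_forms ++ special_forms ++ quads tau.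
have KP : all (nonzero q) K by rewrite !all_cat gen_nz special_nz.
have upp0 (S : lifted 2 n) l1 l2 l3 : (9 <= S.1)%N ->
    (possible_words (fun d => ~~ (8 %| d)%N) (some_class 2 (up_to_sign K)) 6 l1 l2 l3 <= 0)%N ->
    closed_walks m r 6 S l1 l2 l3 = 0%N.
  move=> S_ge h; apply/eqP; rewrite -leqn0.
  exact: (net_upp (L := 6%N) n_ge3 ms_ge3 r_unit r_ms S_ge isT nlP KP h).
have low0 (S : lifted 2 n) l1 l2 l3 : (9 <= S.1)%N ->
    (1 <= sure_words (pred1 0%N) (every_class 2 (trim_or_up_to_sign [::])) 6 l1 l2 l3)%N ->
    (0 < closed_walks m r 6 S l1 l2 l3)%N.
  move=> S_ge; apply: (net_low (L := 6%N) n_ge3 ms_ge3 r_unit r_ms S_ge isT (@dvdn_of_eq0 (m * 2))) => //.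
have peak (S : lifted 2 n) : (9 <= S.1)%N -> only_extension m r 6 S (U false) (D false) (U false).
  move=> S_ge; apply: only_extension_intro; first by [].
    by apply: (upp0 _ _ _ _ S_ge); rewrite /K; case: (tau); vm_compute.
  by move=> [[] []] ne1 ne2; (try by case/eqP: ne1); (try by case/eqP: ne2);
    apply: (low0 _ _ _ _ S_ge); vm_compute.
have valley (S : lifted 2 n) : (9 <= S.1)%N -> only_extension m r 6 S (D false) (U false) (D false).
  move=> S_ge; apply: only_extension_intro; first by [].
    by apply: (upp0 _ _ _ _ S_ge); rewrite /K; case: (tau); vm_compute.
  by move=> [[] []] ne1 ne2; (try by case/eqP: ne1); (try by case/eqP: ne2);
    apply: (low0 _ _ _ _ S_ge); vm_compute.
have [q4 q4E] : exists e : bool, q ^+ 4 = (-1) ^+ e.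
  by apply: sign_of_pm1; move: (q_pow_m r_ms); rewrite m4.
have /hasP[P P_in PV] := good.
have [c cE] : exists c : bool * bool, P = [:: 1; (-1) ^+ ~~ tau; (-1) ^+ c.1; (-1) ^+ c.2].
  by have /mapP[c _ ->] := P_in; exists c.
have PV0 : peval q P = 0 by apply/eqP.
pose P' : seq int := [:: (-1) ^+ ~~ tau; (-1) ^+ c.1; (-1) ^+ c.2; (-1) ^+ q4].
have P'V : vanishing q P'.
  rewrite /vanishing -(mulrI_eq0 _ (mulrI (unitrX 2 r_unit))); apply/eqP.
  transitivity (peval q P - 1 + (-1) ^+ q4 * q ^+ 4).
    rewrite cE /P' /= !signz_intr !mulr0 !addr0; ring.
  by rewrite PV0 q4E -expr2 sqrr_sign sub0r addNr.
have straight (S : lifted 2 n) a b : (9 <= S.1)%N ->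
    only_extension m r 6 S (U a) (U b) (U (a (+) tau)).
  move=> S_ge; apply: only_extension_intro; first by [].
    by apply: (upp0 _ _ _ _ S_ge); rewrite /K; case: (tau); case: a; case: b; vm_compute.
  move=> [[] d] ne1 ne2.
    have dE : d = ~~ (a (+) tau) by move: (a (+) tau) ne2 => x; case: d {ne1} ;  case: x.
    rewrite dE.
    apply: (net_low (L := 6%N) (K := [:: P; P']) n_ge3 ms_ge3 r_unit r_ms S_ge isT zlP).
      by rewrite !all_cons PV P'V.
    by rewrite cE /P'; case: (c) => [[] []]; case: (q4); case: (tau); case: (a); case: (b); vm_compute.
  have dE : d = b by move: ne1; clear; case: d; case: b.
  by rewrite dE; apply: (low0 _ _ _ _ S_ge); case: (a); case: (b); vm_compute.
have ret := return_straight n_ge3 ms_ge3 r_unit r_ms Gamma_2at peak valley straight.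
(* The zigzag of 2n steps shows that n is even; then the one of n steps makes sense and yields 8 |
   n. *)
have [] := ret n; first by rewrite -muln2 dvdn_mulr.
rewrite m4 -muln2 => d8 _.
have d2n : (2 %| n)%N.
  by rewrite -(dvdn_pmul2r (isT : (0 < 2)%N)); apply: dvdn_trans d8.
have n2 : n = (n %/ 2).*2 by rewrite -muln2 divnK.
have [] := ret (n %/ 2)%N; first by rewrite -n2.
rewrite -n2 m4 => {}d8 sum0.
have [k nE] : exists k, n = (k * 8)%N by exists (n %/ 8)%N; rewrite divnK.
have k_gt0 : (0 < k)%N by move: n_ge3; rewrite nE; case: (k).
(* With g = n/8, multiplication by g amounts to reduction modulo 8, where every odd square, so also
   q, is 1. *)
pose g : 'Z_n := k%:R.
have gmul (i : int) : g * i%:~R = 0 -> (8 %| `|i|)%N.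
  move=> /eqP; have -> : g * i%:~R = (Posz k * i)%:~R by rewrite rmorphM.
  by rewrite Zn_int_eq0 // abszM absz_nat {1}nE dvdn_pmul2l.
have gq : g * q = g.
  have rE := Zn_natE r n_gt1.
  have r_odd : odd r.
    move: r_unit; rewrite {1}rE unitZpE // => co.
    rewrite -[odd r]negbK -dvdn2; apply/negP => d.
    have : (2 %| gcdn n r)%N by rewrite dvdn_gcd d2n.
    by rewrite (eqP co).
  have [l rl] : exists l, (r ^ 2 = 8 * l + 1 :> nat)%N.
    have /eqP h : (r ^ 2 == 1 %[mod 8])%N.
      rewrite -modnXm; have : (r %% 8 < 8)%N by rewrite ltn_pmod.
      have : odd (r %% 8) by rewrite odd_mod.
      by case: (r %% 8)%N => [|[|[|[|[|[|[|[|]]]]]]]].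
    by exists (r ^ 2 %/ 8)%N; rewrite {1}(divn_eq (r ^ 2) 8) h mulnC.
  rewrite {1}rE -natrX rl /g -natrM mulnDr muln1 natrD mulnA -nE natrM.
  by rewrite pchar_Zp // mul0r add0r.
have gqX i : g * q ^+ i = g by elim: i => [|i IHi]; rewrite ?mulr1 // exprS mulrA gq.
have q4F : q4 = false.
  apply/negP => q4T; have : g * (2 : int)%:~R = 0.
    have := gqX 4%N; rewrite q4E q4T mulrN1 => e.
    by rewrite -[(2 : int)%:~R]/(2%:R) mulr_natr mulr2n -{1}e addNr.
  by move/gmul.
rewrite q4F expr0 in q4E.
pose y := (-1) ^+ tau * q.
have y4 : y ^+ 4 = 1 by rewrite (exprM y 2 2) /y sign_sqr -(exprM q 2 2).
have halfE : (n %/ 2 = k * 4)%N by rewrite {1}nE -[8%N]/(4 * 2)%N mulnA mulnK.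
rewrite halfE (sum_expr_period4 _ y4) -/g in sum0.
have gy i : g * y ^+ i = (-1) ^+ (tau * i) * g.
  by rewrite /y exprMn mulrCA gqX exprM.
(* Without the sign every power of y fixes g, and the zigzag sum becomes 4g = 0. *)
have tauT : tau.
  apply/negPn/negP => /negPf tauF; have : g * (4 : int)%:~R = 0.
    rewrite -[RHS]sum0 !mulrDr -[y]expr1 -!exprM !gy tauF !mul0n !expr0 mulr1 !mul1r.
    by rewrite !addrA.
  by move/gmul.
rewrite tauT in cE bad; move: PV0; rewrite cE /= mulr0 addr0 => PV0.
(* On g the vanishing form is 2 plus two signs, which 8 divides only if it is 0. *)
have cT : c = (true, true).
  have : g * (2 + (-1) ^+ c.1 + (-1) ^+ c.2 : int)%:~R = 0.
    have -> : (2 + (-1) ^+ c.1 + (-1) ^+ c.2 : int)%:~R =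
        2 + (-1) ^+ c.1 + (-1) ^+ c.2 :> 'Z_n by rewrite 2!rmorphD /= !signz_intr.
    move: PV0; rewrite !signz_intr expr0.
    set A : 'Z_n := (-1) ^+ c.1; set B : 'Z_n := (-1) ^+ c.2 => PV0.
    rewrite -[RHS](mulr0 g) -PV0.
    transitivity (g + g * q + A * (g * q ^+ 2) + B * (g * q ^+ 3)); last by ring.
    by rewrite gq (gqX 2%N) (gqX 3%N); ring.
  by move/gmul; case: (c) => [[] []].
rewrite cT /= in PV0.
have /allP/(_ [:: 1; -1; -1; 1]) := bad.
have -> : ([:: 1; -1; -1; 1] : seq int) \in quads true by [].
move=> /(_ isT)/negP; apply; apply/eqP.
(* Multiplying 1 + q - q^2 - q^3 = 0 by -q and using q^4 = 1 gives 1 - q - q^2 + q^3 = 0, a form of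
   the other sign. *)
transitivity (- (q * (1%:~R + q * (1%:~R + q * ((-1)%:~R + q * (-1)%:~R)))) + (1 - q ^+ 4)).
  by rewrite /=; ring.
by rewrite [X in q * X]PV0 q4E subrr mulr0 oppr0 addr0.
Qed.

End GenericSquareExcluded.

(** * Two directions: squares with 2q = 2 or 2q = -2 *)

Lemma half_mul_unit n (u : 'Z_n) : (1 < n)%N -> (2 %| n)%N -> u \is a GRing.unit ->
  (n %/ 2)%:R * u = (n %/ 2)%:R.
Proof.
move=> n_gt1 n_even; rewrite [u](Zn_natE _ n_gt1) unitZpE // => co.
have u_odd : odd u.
  rewrite -[odd u]negbK -dvdn2; apply/negP => d.
  have : (2 %| gcdn n u)%N by rewrite dvdn_gcd n_even.
  by rewrite (eqP co).
have -> : (u : nat) = (1 + u./2 * 2)%N by rewrite muln2 -{1}[(u : nat)]odd_double_half u_odd.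
rewrite -natrM mulnDr muln1 mulnCA [(n %/ 2 * 2)%N]divnK // natrD natrM.
by rewrite pchar_Zp // mulr0 addr0.
Qed.

Lemma half_neq0 n : (1 < n)%N -> (2 %| n)%N -> ((n %/ 2)%:R : 'Z_n) != 0.
Proof.
move=> n_gt1 n_even; rewrite Zn_nat_eq0 //; apply/negP => /dvdn_leq.
by move: n_gt1 (divnK n_even); case: (n %/ 2)%N => [|k]; lia.
Qed.

Lemma double_eq0 n (x : 'Z_n) : (1 < n)%N -> 2 * x = 0 ->
  x = 0 \/ (2 %| n)%N /\ x = (n %/ 2)%:R.
Proof.
move=> n_gt1; rewrite (Zn_natE x n_gt1) -natrM => /eqP; rewrite Zn_nat_eq0 //.
have x_lt : (x < n)%N by rewrite -[X in (_ < X)%N](Zp_cast n_gt1).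
move=> /dvdnP[[|[|k]]]; rewrite ?mul0n ?mul1n => e.
- by left; have -> : (x : nat) = 0%N by lia.
- have half k : (2 * k)%N = n -> (n %/ 2)%N = k by move=> <-; rewrite mulKn.
  by right; split; [rewrite -[X in (_ %| X)%N]e dvdn_mulr|rewrite (half _ e)].
- by exfalso; move: e; rewrite !mulSn; lia.
Qed.

(** Its vanishing says 2y = 2 for y = q or -q according to b, the closing condition of
    up-up-up-down-down-down. *)
Definition folded (b : bool) : seq int := [:: 2; (-1) ^+ (~~ b) * 2].
(** The coefficients 3 come from hexagons with a single down step, which pass one layer three times
    and climb four layers; the triples come from six steps up. *)
Definition folded_forms (b : bool) : seq (seq int) :=
  [:: [:: 1]; [:: 2]; [:: 4]; [:: 2; (-1) ^+ b * 2];
      [:: 3; (-1) ^+ false * 1]; [:: 3; (-1) ^+ true * 1];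
      [:: 1; (-1) ^+ false * 3]; [:: 1; (-1) ^+ true * 3]] ++ triples.

Section FoldedSquare.
Variables (m n : nat) (r : 'Z_n).
Hypothesis m_gt0 : (0 < m)%N.
Hypothesis n_ge3 : (3 <= n)%N.
Hypothesis n_neq4 : n <> 4%N.
Hypothesis ms_ge3 : (3 <= m * 2)%N.
Hypothesis r_unit : r \is a GRing.unit.
Hypothesis r_ms : r ^+ (m * 2) = 1 \/ r ^+ (m * 2) = -1.
Hypothesis Gamma_2at : two_arc_transitive (CPM m 2 n r).
Local Notation q := (r ^+ 2).
Let n_gt1 : (1 < n)%N. Proof. exact: ltnW. Qed.

Lemma folded_exists : exists b, vanishing q (folded b).
Proof.
have [h|h1] := boolP (vanishing q (folded false)); first by exists false.
have [h|h2] := boolP (vanishing q (folded true)); first by exists true.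
by exfalso; apply: (generic_square_excluded m_gt0 n_ge3 n_neq4 ms_ge3 r_unit r_ms Gamma_2at).
Qed.

Variable b : bool.
Hypothesis q_folded : vanishing q (folded b).
Local Notation y := ((-1) ^+ b * q).

Lemma double_y : 2 * y = 2.
Proof.
move: q_folded; rewrite /vanishing /folded peval2_sign signrN mulNr mulrN subr_eq0.
by move/eqP=> <-.
Qed.

Lemma y_unit : y \is a GRing.unit.
Proof. by rewrite unitrM unitrX ?unitrN1 // unitrX. Qed.

Section NotThree.
Hypothesis n_neq3 : n <> 3%N.

Lemma dvd24_y : (8 : 'Z_n) = 0 -> q = 1.
Proof.
move=> h8; apply: unit_sqr_dvd24 => //; rewrite -Zn_nat_eq0 //.
have -> : 24%:R = 3 * 8 :> 'Z_n by ring.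
by rewrite h8 mulr0.
Qed.

(** As 2q is 2 or -2, the doubles of the forms with a 3 are 4 or 8 up to sign, and 8 = 0 would give
    q = 1 and leave 2 or 4. For a triple, either q is a sign and its value is 1 or 3 up to sign, or
    n is even and multiplying by n/2 gives 3(n/2) = n/2. *)
Lemma folded_forms_nonzero : all (nonzero q) (folded_forms b).
Proof.
have n2 := two_neq0 n_ge3 n_neq4; have n4 := four_neq0 n_ge3 n_neq4.
have small k : k \in [:: 1; 2; 4] -> nonzero q [:: k].
  by rewrite /nonzero peval1; apply: small_neq0.
have yy (c : bool) : 2 * ((-1) ^+ c * q) = (-1) ^+ (c (+) b) * 2 :> 'Z_n.
  transitivity ((-1) ^+ (c (+) b) * (2 * y)); last by rewrite double_y.
  rewrite signr_addb; set C := (-1) ^+ c; set B := (-1) ^+ b.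
  have -> : C * B * (2 * (B * q)) = (B * B) * (2 * (C * q)) by ring.
  by rewrite -expr2 sqrr_sign mul1r.
have n22 : nonzero q [:: 2; (-1) ^+ b * 2].
  rewrite /nonzero peval2_sign; apply: contra n4 => /eqP h; apply/eqP.
  rewrite -[RHS]h -[2%:~R * y]/(2 * y) double_y; ring.
have q1_sign (c : bool) : (8 : 'Z_n) = 0 -> (-1) ^+ c * q = (-1) ^+ c :> 'Z_n.
  by move/dvd24_y->; rewrite mulr1.
have n31 (c : bool) : nonzero q [:: 3; (-1) ^+ c * 1].
  rewrite /nonzero peval2_sign mul1r; apply/negP => /eqP h; have {}h : 3 + (-1) ^+ c * q = 0 := h.
  have : 6 + 2 * ((-1) ^+ c * q) = 0.
    have -> : 6 + 2 * ((-1) ^+ c * q) = 2 * (3 + (-1) ^+ c * q) by ring.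
    by rewrite h mulr0.
  rewrite yy; case: (c (+) b) => h2.
    by move/eqP: n4; apply; rewrite -[RHS]h2; ring.
  have h8 : (8 : 'Z_n) = 0 by rewrite -[RHS]h2; ring.
  move: h; rewrite q1_sign //; case: (c) => h.
    by move/eqP: n2; apply; rewrite -[RHS]h; ring.
  by move/eqP: n4; apply; rewrite -[RHS]h; ring.
have n13 (c : bool) : nonzero q [:: 1; (-1) ^+ c * 3].
  rewrite /nonzero peval2_sign; apply/negP => /eqP h; have {}h : 1 + 3 * ((-1) ^+ c * q) = 0 := h.
  have : 2 + 3 * (2 * ((-1) ^+ c * q)) = 0.
    have -> : 2 + 3 * (2 * ((-1) ^+ c * q)) = 2 * (1 + 3 * ((-1) ^+ c * q)) by ring.
    by rewrite h mulr0.
  rewrite yy; case: (c (+) b) => h2.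
    move/eqP: n4; apply; apply: oppr_inj; rewrite oppr0 -[RHS]h2; ring.
  have h8 : (8 : 'Z_n) = 0 by rewrite -[RHS]h2; ring.
  move: h; rewrite q1_sign //; case: (c) => h.
    by move/eqP: n2; apply; apply: oppr_inj; rewrite oppr0 -[RHS]h; ring.
  by move/eqP: n4; apply; rewrite -[RHS]h; ring.
have ntr (c : bool * bool) : nonzero q [:: 1; (-1) ^+ c.1; (-1) ^+ c.2].
  apply/negP; rewrite /vanishing /= !signz_intr mulr0 addr0 => /eqP h.
  have {}h : 1 + (-1) ^+ c.1 * q + (-1) ^+ c.2 * q ^+ 2 = 0 by rewrite -[RHS]h; ring.
  have y1' : 2 * (y - 1) = 0 by rewrite mulrBr double_y mulr1 subrr.
  have [y1|[n_even yh]] := double_eq0 n_gt1 y1'; last first.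
    move/eqP: (half_neq0 n_gt1 n_even); apply.
    have e (u : 'Z_n) : u \is a GRing.unit -> (n %/ 2)%:R * u = (n %/ 2)%:R.
      exact: half_mul_unit.
    have sq : (-1) ^+ c.1 * q \is a GRing.unit by rewrite unitrM unitrX ?unitrN1 ?unitrX.
    have sq2 : (-1) ^+ c.2 * q ^+ 2 \is a GRing.unit by rewrite unitrM unitrX ?unitrN1 ?unitrX.
    have := congr1 (fun z => (n %/ 2)%:R * z) h; rewrite /= mulr0 !mulrDr mulr1 !e //.
    move=> h3; rewrite -[RHS]h3 -natrD addnn -muln2 divnK // pchar_Zp // add0r.
    by [].
  have qE : q = (-1) ^+ b.
    have {}y1 : y = 1 by apply/eqP; rewrite -subr_eq0 y1.
    have qy : (-1) ^+ b * y = q by rewrite mulrA -signr_addb addbb mul1r.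
    by rewrite -[LHS]qy y1 mulr1.
  have : (1 + (-1) ^+ c.1 * (-1) ^+ b + (-1) ^+ c.2 : int)%:~R = 0 :> 'Z_n.
    rewrite -[RHS]h qE sqrr_sign mulr1 2!rmorphD rmorphM /= !signz_intr; by [].
  move=> /eqP; rewrite Zn_int_eq0 // => d.
  have d3 : (n %| 3)%N || (n %| 1)%N by move: d; case: (c) => [[] []]; case: (b) => /= ->; rewrite ?orbT.
  case/orP: d3 => /dvdn_leq-/(_ isT); first by move: n_neq3; lia.
  by rewrite leqNgt n_gt1.
rewrite /folded_forms all_cat; apply/andP; split.
  by rewrite !all_cons (small 1) // (small 2) // (small 4) // n22 !n31 !n13.
by apply/allP => P /mapP[c _ ->]; apply: ntr.
Qed.

Definition hex_gaps (d : nat) : bool := odd d || (d == 2)%N.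

Lemma hex_gapsP d : hex_gaps d -> ~~ (m * 2 %| d)%N.
Proof.
case/orP=> [d_odd|/eqP->]; last by apply/negP => /dvdn_leq; lia.
by apply/negP => /(dvdn_trans (dvdn_mull m (dvdnn 2))); rewrite dvdn2 d_odd.
Qed.

Lemma hex_upp (S : lifted 2 n) K l1 l2 l3 : (9 <= S.1)%N -> all (nonzero q) K ->
  (possible_words hex_gaps (some_class 2 (up_to_sign (folded_forms b ++ K))) 4 l1 l2 l3 <= 0)%N ->
  closed_walks m r 4 S l1 l2 l3 = 0%N.
Proof.
move=> S_ge KP h; apply/eqP; rewrite -leqn0.
apply: (net_upp (L := 4%N) n_ge3 ms_ge3 r_unit r_ms S_ge isT hex_gapsP _ h).
by rewrite all_cat folded_forms_nonzero.
Qed.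

End NotThree.

Lemma hex_low (S : lifted 2 n) K l1 l2 l3 : (9 <= S.1)%N -> all (vanishing q) K ->
  (1 <= sure_words (pred1 0%N) (every_class 2 (trim_or_up_to_sign (folded b :: K))) 4 l1 l2 l3)%N ->
  (0 < closed_walks m r 4 S l1 l2 l3)%N.
Proof.
move=> S_ge KP; apply: (net_low (L := 4%N) n_ge3 ms_ge3 r_unit r_ms S_ge isT (@dvdn_of_eq0 (m * 2))).
by rewrite all_cons q_folded.
Qed.

(** Since 6 = 0, up-down-up-down-up-down closes; up-up-up-down-down-down covers the other two
    extensions. *)
Lemma hex_turn_pos (S : lifted 2 n) l : (9 <= S.1)%N -> (n %| 6)%N ->
  l != letter_inv (D false) -> (0 < closed_walks m r 4 S (U false) (D false) l)%N.
Proof.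
move=> S_ge n6 l_ok; apply: (hex_low (K := [:: [:: 6]])) => //.
  by rewrite all_cons andbT /vanishing peval1 -[6%:~R]/(6%:R : 'Z_n) Zn_nat_eq0.
by case: l l_ok => [[] []] // _; case: (b); vm_compute.
Qed.

Lemma hex_straight_zero (S : lifted 2 n) a c : n <> 3%N -> (9 <= S.1)%N ->
  closed_walks m r 4 S (U a) (U c) (U (a (+) b)) = 0%N.
Proof.
move=> n3 S_ge; apply: (hex_upp n3 S_ge (K := [::])) => //.
by case: (b); case: a; case: c; vm_compute.
Qed.

Lemma n_neq6 : n <> 6%N.
Proof.
move=> n6; have n3 : n <> 3%N by rewrite n6.
have n_dvd6 : (n %| 6)%N by rewrite n6.
have [S S_ge S_root] := root_lift r ms_ge3.
apply: (count_contra1 (turn_straight n_ge3 ms_ge3 r_unit r_ms Gamma_2at S_ge S_root (pred1 0%N) 4)).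
- by rewrite [pred1 _ _]eqn0Ngt hex_turn_pos.
- by rewrite [pred1 _ _]eqn0Ngt hex_turn_pos.
- by rewrite [pred1 _ _]eqn0Ngt hex_turn_pos.
- by have := hex_straight_zero false false n3 S_ge; case: (b) => ->; rewrite ?orbT.
Qed.

Lemma odd_case : ~~ (2 %| n)%N -> y = 1.
Proof.
move=> n_odd; have y1' : 2 * (y - 1) = 0 by rewrite mulrBr double_y mulr1 subrr.
have [e|[n_even _]] := double_eq0 n_gt1 y1'; last by rewrite n_even in n_odd.
by apply/eqP; rewrite -subr_eq0 e.
Qed.

Section Zigzags.
Hypothesis n_neq3 : n <> 3%N.

Lemma n_ndvd6 : ~~ (n %| 6)%N.
Proof.
apply/negP => h; have := dvdn_leq (isT : (0 < 6)%N) h; move: n_ge3 n_neq3 n_neq4 n_neq6 h.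
by case: (n) => [|[|[|[|[|[|[|]]]]]]].
Qed.

Lemma six_nonzero : all (nonzero q) [:: [:: 6]].
Proof. by rewrite all_cons andbT /nonzero peval1 -[6%:~R]/(6%:R : 'Z_n) Zn_nat_eq0 // n_ndvd6. Qed.

Lemma hex_peak (S : lifted 2 n) : (9 <= S.1)%N ->
  only_extension m r 4 S (U false) (D false) (U false).
Proof.
move=> S_ge; apply: only_extension_intro; first by [].
  by apply: (hex_upp n_neq3 S_ge six_nonzero); case: (b); vm_compute.
move=> [[] []] ne1 ne2; (try by case/eqP: ne1); (try by case/eqP: ne2);
  by apply: (hex_low (K := [::]) S_ge isT); case: (b); vm_compute.
Qed.

Lemma hex_valley (S : lifted 2 n) : (9 <= S.1)%N ->
  only_extension m r 4 S (D false) (U false) (D false).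
Proof.
move=> S_ge; apply: only_extension_intro; first by [].
  by apply: (hex_upp n_neq3 S_ge six_nonzero); case: (b); vm_compute.
move=> [[] []] ne1 ne2; (try by case/eqP: ne1); (try by case/eqP: ne2);
  by apply: (hex_low (K := [::]) S_ge isT); case: (b); vm_compute.
Qed.

Lemma hex_straight (S : lifted 2 n) a c : (9 <= S.1)%N ->
  only_extension m r 4 S (U a) (U c) (U (a (+) b)).
Proof.
move=> S_ge; apply: only_extension_intro; first by [].
  exact: hex_straight_zero.
move=> [[] d] ne1 ne2.
  have dE : d = ~~ (a (+) b) by move: (a (+) b) ne2 => x; case: d {ne1}; case: x.
  by rewrite dE; apply: (hex_low (K := [::]) S_ge isT); case: (b); case: (a); case: (c); vm_compute.
have dE : d = c by move: ne1; clear; case: d; case: c.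
by rewrite dE; apply: (hex_low (K := [::]) S_ge isT); case: (b); case: (a); case: (c); vm_compute.
Qed.

(** If y = 1, the returning straight zigzag of n steps would give n/2 = 0. So y = 1 + n/2; units fix
    n/2, hence (n/2)^2 = 0 and 4 | n. Then y^2 = 1, and for odd m the sign y^m would be y itself, so
    y = -1, n/2 = -2 and 4 = (n/2)^2 = 0. *)
Lemma even_case : (2 %| n)%N ->
  [/\ (4 %| n)%N, (2 %| m)%N & y = 1 + (n %/ 2)%:R].
Proof.
move=> n_even; have h0 := half_neq0 n_gt1 n_even.
have hu (u : 'Z_n) : u \is a GRing.unit -> (n %/ 2)%:R * u = (n %/ 2)%:R.
  exact: half_mul_unit.
have h2 : (n %/ 2)%:R * 2 = 0 :> 'Z_n by rewrite -natrM divnK // pchar_Zp.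
have y_neq1 : y != 1.
  apply/negP => /eqP y1; move/eqP: h0; apply.
  have [|_] := return_straight n_ge3 ms_ge3 r_unit r_ms Gamma_2at hex_peak hex_valley
    hex_straight (h := (n %/ 2)%N); first by rewrite -muln2 divnK.
  rewrite y1; under eq_bigr do rewrite expr1n.
  by rewrite sumr_const card_ord.
have y1' : 2 * (y - 1) = 0 by rewrite mulrBr double_y mulr1 subrr.
have yE : y = 1 + (n %/ 2)%:R.
  have [e|[_ <-]] := double_eq0 n_gt1 y1'; last by rewrite addrC subrK.
  by case/eqP: y_neq1; apply/eqP; rewrite -subr_eq0 e.
have hh : (n %/ 2)%:R * (n %/ 2)%:R = 0 :> 'Z_n.
  have := hu y y_unit; rewrite yE mulrDr mulr1 => e.
  by apply: (addrI (n %/ 2)%:R); rewrite addr0.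
have n4 : (4 %| n)%N.
  move/eqP: hh; rewrite -natrM Zn_nat_eq0 // -{1}(divnK n_even).
  have h_gt0 : (0 < n %/ 2)%N by rewrite divn_gt0 // dvdn_leq // ltnW.
  by rewrite dvdn_pmul2l // -(dvdn_pmul2r (isT : (0 < 2)%N)) divnK.
split=> //; have y2 : y ^+ 2 = 1.
  rewrite yE; set h : 'Z_n := (n %/ 2)%:R.
  have -> : (1 + h) ^+ 2 = 1 + h * 2 + h * h by ring.
  by rewrite h2 hh !addr0.
rewrite -[(2 %| m)%N]negbK dvdn2 negbK; apply/negP => m_odd.
have odd_pow (z : 'Z_n) : z ^+ 2 = 1 -> z ^+ m = z.
  move=> z2; rewrite -[m]odd_double_half m_odd -mul2n exprD exprM z2 expr1n.
  by rewrite expr1 mulr1.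
have [c cE] := sign_of_pm1 (q_pow_m r_ms).
have := odd_pow y y2; rewrite exprMn (odd_pow _ (sqrr_sign _ b)) cE -signr_addb.
case: (b (+) c) => e; last by case/eqP: y_neq1; rewrite -e.
move/eqP: (four_neq0 n_ge3 n_neq4); apply.
have hE : (n %/ 2)%:R = - 2 :> 'Z_n.
  by apply: (addrI 1); rewrite -yE -e expr1; ring.
by rewrite -[RHS]hh hE; ring.
Qed.

End Zigzags.
End FoldedSquare.

(** * The order of the component *)

Definition doubles (n : nat) : {set 'rV['Z_n]_2} := [set v *+ 2 | v : 'rV['Z_n]_2].

Section Doubles.
Variable n : nat.
Hypothesis n_gt1 : (1 < n)%N.

Lemma doubles0 : 0 \in doubles n.
Proof. by apply/imsetP; exists 0; rewrite ?mul0rn. Qed.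

Lemma doublesD u v : u \in doubles n -> v \in doubles n -> u + v \in doubles n.
Proof.
move=> /imsetP[x _ ->] /imsetP[z _ ->]; apply/imsetP; exists (x + z) => //.
by rewrite mulrnDl.
Qed.

Lemma doublesN u : u \in doubles n -> - u \in doubles n.
Proof. by move=> /imsetP[x _ ->]; apply/imsetP; exists (- x); rewrite ?mulNrn. Qed.

Lemma doublesDl u v : u \in doubles n -> (v + u \in doubles n) = (v \in doubles n).
Proof.
move=> u_in; apply/idP/idP => [h|h]; last exact: doublesD.
by rewrite -[v](addrK u); apply: doublesD => //; apply: doublesN.
Qed.

Lemma doubles_odd u : odd n -> u \in doubles n.
Proof.
(* (n + 1)/2 inverts 2. *)
move=> n_odd; apply/imsetP; exists (u *+ (n./2).+1) => //.
have nE : ((n./2).+1 * 2 = n + 1)%N by have := odd_double_half n; rewrite n_odd; lia.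
by rewrite -mulrnA nE mulrnDr mulr1n -scaler_nat pchar_Zp // scale0r add0r.
Qed.

Lemma doubles_one_unit (u : 'Z_n) v : (2 %| n)%N -> u \is a GRing.unit ->
  v + u *: v \in doubles n.
Proof.
move=> n_even; rewrite [u](Zn_natE _ n_gt1) unitZpE // => co.
have u_odd : odd u.
  rewrite -[odd u]negbK -dvdn2; apply/negP => d.
  have : (2 %| gcdn n u)%N by rewrite dvdn_gcd n_even.
  by rewrite (eqP co).
apply/imsetP; exists (v *+ (u./2).+1) => //.
rewrite -mulrnA muln2 doubleS scaler_nat -mulrS.
by rewrite -{1}[(u : nat)]odd_double_half u_odd.
Qed.

End Doubles.

Section Layers.
Variables (m n : nat) (r : 'Z_n).
Hypothesis n_ge3 : (3 <= n)%N.
Hypothesis ms_ge3 : (3 <= m * 2)%N.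
Hypothesis r_unit : r \is a GRing.unit.
Hypothesis r_ms : r ^+ (m * 2) = 1 \/ r ^+ (m * 2) = -1.
Hypothesis parity : odd n \/ (2 %| n)%N /\ (2 %| m)%N.
Let n_gt1 : (1 < n)%N. Proof. exact: ltnW. Qed.
Let ms_gt1 : (1 < m * 2)%N. Proof. exact: ltnW. Qed.

Local Notation cov := (@cov m 2 n r).
Local Notation step := (@step 2 n r).
Local Notation gen := (gen 2 r).
Local Notation G := (CPMbar m 2 r).

(** Endpoint of the climb from the root with all signs plus; the component meets layer i in the
    translate of [doubles n] by it. *)
Definition centre (i : nat) : 'rV['Z_n]_2 := \sum_(k < i) gen k.

Lemma gen_shift2 k : gen k.+2 = r ^+ 2 *: gen k.
Proof.
by rewrite /gen scalerA -exprD; congr (_ *: _).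
Qed.

(** Makes the description of layers consistent after a full turn. For even n, m is even and the
    climb splits into blocks of four layers; layers k and k + 2 together give (1 + q) [gen k], and q
    is odd. *)
Lemma centre_period : centre (m * 2) \in doubles n.
Proof.
have [n_odd|[n_even m_even]] := parity; first exact: doubles_odd.
rewrite -(divnK m_even) -mulnA; elim: (m %/ 2)%N => [|k IHk].
  by rewrite /centre mul0n big_ord0 doubles0.
rewrite /centre mulSn addnC !addnS addn0 !big_ord_recr /=.
have -> : forall a b c d e : 'rV['Z_n]_2, a + b + c + d + e = a + ((b + d) + (c + e)).
  by move=> a b c d e; rewrite -!addrA; congr (_ + (_ + _)); rewrite addrCA.
apply: doublesD => //; apply: doublesD; rewrite gen_shift2;
  by apply: doubles_one_unit => //; apply: unitrX.
Qed.

Lemma step_edge S l : (0 < S.1)%N -> sedge (cov S) (cov (step S l)).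
Proof.
by move=> S_gt0; rewrite (cov_nbr ms_ge3 r_ms) //; apply/mapP; exists l; case: l => [[] []].
Qed.

Definition in_layer : pred G := fun x => x.2 - centre x.1 \in doubles n.

Lemma in_layer_arc (x y : G) : cpm_arc r x y -> in_layer x = in_layer y.
Proof.
have [v xE] : exists v, x = cov (x.1 : nat, v).
  by exists x.2; rewrite /cov -(Zn_natE _ ms_gt1); case: x.
have j_lt : (x.1 < m * 2)%N by rewrite -[X in (_ < X)%N](Zp_cast ms_gt1).
move: (x.1 : nat) j_lt xE => j j_lt ->{x}.
have covE T : in_layer (cov T) = (T.2 - centre (T.1 %% (m * 2)) \in doubles n).
  by rewrite /in_layer /cov [_.2]/= [_.1]/= val_Zp_nat.
have next b : in_layer (cov (j, v)) = in_layer (cov (step (j, v) (true, b))).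
  rewrite !covE [_.2]/= [_.1]/= modn_small //.
  rewrite [(step _ _).2]/= [(step _ _).1]/=.
  have -> : (v + (-1) ^+ b *: gen j - centre (j.+1 %% (m * 2)) \in doubles n) =
      (v + (-1) ^+ b *: gen j - centre j.+1 \in doubles n).
    (* The step from the last layer to layer 0 replaces [centre (m * 2)] by 0, harmless by
       [centre_period]. *)
    have [lt|] := ltnP j.+1 (m * 2); first by rewrite modn_small.
    rewrite leq_eqVlt ltnS leqNgt j_lt orbF => /eqP <-.
    rewrite modnn {1}/centre big_ord0 oppr0 addr0.
    by rewrite -[RHS](doublesDl _ centre_period) subrK.
  rewrite /centre big_ord_recr /= opprD addrACA.
  have d : (-1) ^+ b *: gen j - gen j \in doubles n.
    case: b; last by rewrite scale1r subrr doubles0.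
    rewrite scaleN1r -opprD doublesN //; apply/imsetP; exists (gen j) => //.
  by rewrite (doublesDl _ d).
by rewrite (arc_cov ms_ge3 r_ms) => /orP[] /eqP->; apply: next.
Qed.

Lemma connect_in_layer (x : G) : connect (@sedge G) (0, 0) x -> in_layer x.
Proof.
have cl : closed (@sedge G) in_layer.
  move=> u v /orP[/in_layer_arc//|/in_layer_arc]; exact: esym.
move/(closed_connect cl) => e; rewrite -[in_layer x]/(x \in in_layer) -e.
by rewrite unfold_in /in_layer [_.2]/= [_.1]/= /centre big_ord0 subrr doubles0.
Qed.

Lemma connect_two_steps S b : (1 < S.1)%N ->
  connect (@sedge G) (cov S) (cov (S.1, S.2 + gen (if b then S.1 else S.1.-1) *+ 2)).
Proof.
case: S => [[|[|j]] v] // _; pose S : lifted 2 n := (j.+2, v).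
have e1 := step_edge (b, false) (S := S) isT.
have T_gt0 : (0 < (step S (b, false)).1)%N by rewrite /step; case: (b).
have e2 := step_edge (~~ b, false) T_gt0.
apply: connect_trans (connect1 e1) _.
suff -> : (j.+2, v + gen (if b then j.+2 else j.+1) *+ 2) =
  step (step S (b, false)) (~~ b, false) by apply: connect1 e2.
by rewrite /S /step; case: (b); rewrite /= scale1r mulr2n addrA.
Qed.

Lemma connect_doubles S u : (1 < S.1)%N -> u \in doubles n ->
  connect (@sedge G) (cov S) (cov (S.1, S.2 + u)).
Proof.
case: S => [j v] /= j_gt1 /imsetP[w _ ->].
have many b (c : nat) v' : connect (@sedge G) (cov (j, v'))
    (cov (j, v' + gen (if b then j else j.-1) *+ 2 *+ c)).
  elim: c v' => [|c IHc] v'; first by rewrite mulr0n addr0 connect0.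
  rewrite mulrS addrA; apply: connect_trans (IHc _).
  exact: (connect_two_steps (S := (j, v')) b).
pose i1 := Ordinal (ltn_pmod j (isT : (0 < 2)%N)).
pose i2 := Ordinal (ltn_pmod j.-1 (isT : (0 < 2)%N)).
(* Adjacent layers have different directions, so [gen j] and [gen j.-1] form a basis, in which w has
   coordinates a and b. *)
pose a : 'Z_n := w 0 i1 / r ^+ j; pose b : 'Z_n := w 0 i2 / r ^+ j.-1.
suff -> : w *+ 2 = gen j *+ 2 *+ a + gen j.-1 *+ 2 *+ b.
  by rewrite addrA; apply: connect_trans (many true _ _) (many false _ _).
have -> : gen j *+ 2 *+ a + gen j.-1 *+ 2 *+ b = (a *: gen j + b *: gen j.-1) *+ 2.
  by rewrite -!mulrnA ![(2 * _)%N]mulnC !mulrnA -mulrnDl {2}(Zn_natE a n_gt1)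
    {2}(Zn_natE b n_gt1) !scaler_nat.
congr (_ *+ 2); apply/rowP => i; rewrite !mxE /a /b.
rewrite !mulrA !divrK ?unitrX //.
have par : (j %% 2 != j.-1 %% 2)%N.
  by case: j j_gt1 {many i1 i2 a b} => [//|k] _; rewrite !modn2 /=; case: (odd k).
have [e|ne] := eqVneq i i1.
  rewrite e [(_ == _ :> nat)]eqxx mulr1 -[(i1 : nat) == _]/((j %% 2 == j.-1 %% 2)%N).
  by rewrite (negPf par) mulr0 addr0.
have e : i = i2.
  apply/val_inj; move: ne; rewrite -(inj_eq val_inj) /=.
  have := ltn_ord i; move: par; rewrite !modn2.
  by case: (i : nat) => [|[|]] //; case: (odd j); case: (odd j.-1).
rewrite e -[(i2 : nat) == _]/((j.-1 %% 2 == j %% 2)%N) eq_sym (negPf par) mulr0 add0r.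
by rewrite [(_ == _ :> nat)]eqxx mulr1.
Qed.

Lemma connect_centre i : connect (@sedge G) (0, 0) (cov (i, centre i)).
Proof.
elim: i => [|i IHi].
  suff -> : cov (0%N, centre 0) = (0, 0) by apply: connect0.
  by rewrite /cov /centre big_ord0.
apply: connect_trans IHi (connect1 _).
rewrite /sedge /= /cpm_edge (arc_cov ms_ge3 r_ms); apply/orP; left; apply/orP; left.
by rewrite /step /= scale1r /centre big_ord_recr.
Qed.

Lemma in_layer_connect (x : G) : in_layer x -> connect (@sedge G) (0, 0) x.
Proof.
move=> x_in; apply: connect_trans (connect_centre x.1) _.
(* A lift of the layer large enough for steps down. *)
pose j := (m * 2 + x.1)%N.
have cE v : cov (x.1 : nat, v) = cov (j, v).
  by rewrite /cov [_.1]/= [_.2]/= [(_, _).1]/= [(_, _).2]/= natrD pchar_Zp // add0r.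
have xE : x = cov (x.1 : nat, x.2).
  by rewrite /cov -(Zn_natE _ ms_gt1); case: x {x_in j cE}.
rewrite {3}xE !cE -[x.2](subrK (centre x.1)) addrC.
apply: (connect_doubles (S := (j, centre x.1))) => //.
by rewrite /j; apply: leq_trans ms_gt1 (leq_addr _ _).
Qed.

Lemma card_CPM : #|CPM m 2 n r| = (m * 2 * #|doubles n|)%N.
Proof.
pose f (u : 'Z_(m * 2) * 'rV['Z_n]_2) : G := (u.1, u.2 + centre u.1).
have f_inj : injective f by move=> [i u] [k v] [<-] /addIr->.
rewrite card_sig.
have -> : #|[pred x : G | connect (@sedge G) (0, 0) x]| =
    #|f @: setX [set: 'Z_(m * 2)] (doubles n)|.
  apply: eq_card => x; rewrite inE; apply/idP/imsetP => [/connect_in_layer x_in|].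
    exists (x.1, x.2 - centre x.1); first by rewrite inE /= inE.
    by rewrite /f [_.1]/= [_.2]/= subrK; case: x {x_in}.
  case=> [[i u]]; rewrite inE /= inE => u_in ->; apply: in_layer_connect.
  by rewrite /in_layer /f ![(_, _).1]/= ![(_, _).2]/= addrK.
by rewrite card_imset // cardsX cardsT card_ord Zp_cast.
Qed.

End Layers.

(** * Rescaling isomorphisms and the theorem *)

Lemma connect_homo (G H : sgraph) (f : G -> H) x y :
  {homo f : x y / sedge x y} -> connect (@sedge G) x y -> connect (@sedge H) (f x) (f y).
Proof.
move=> f_homo /connectP[p p_path ->]; apply/connectP; exists (map f p).
  by rewrite path_map; apply: sub_path p_path => u v; apply: f_homo.
by rewrite last_map.
Qed.

Lemma isomorphic_component (G H : sgraph) (x0 : G) (f : G -> H) :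
  bijective f -> {mono f : x y / sedge x y} ->
  isomorphic (component x0) (component (f x0)).
Proof.
move=> [g fK gK] f_mono.
have g_mono : {mono g : x y / sedge x y} by move=> x y; rewrite -f_mono !gK.
have f_conn (x : component x0) : connect (@sedge H) (f x0) (f (val x)).
  by apply: connect_homo (valP x) => u v; rewrite f_mono.
have g_conn (y : component (f x0)) : connect (@sedge G) x0 (g (val y)).
  by rewrite -[X in connect _ X _]fK; apply: connect_homo (valP y) => u v; rewrite g_mono.
exists (fun x => Sub (f (val x)) (f_conn x)).
  exists (fun y => Sub (g (val y)) (g_conn y)) => x; apply/val_inj.
    by rewrite !SubK fK.
  by rewrite !SubK gK.
by move=> x y; rewrite /sedge /= /component_edge /= f_mono.
Qed.

Section Rescale.
Variables (m n : nat) (r r' u : 'Z_n).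
Hypothesis rE : r = r' * u.
Hypothesis u2 : u ^+ 2 = 1 \/ u ^+ 2 = -1.

Definition rescale (v : 'rV['Z_n]_2) : 'rV['Z_n]_2 := \row_l (v 0 l * u ^+ l).

Lemma u_unit : u \is a GRing.unit.
Proof.
by rewrite -(unitrX_pos _ (isT : (0 < 2)%N)); case: u2 => ->; rewrite ?unitrN1 ?unitr1.
Qed.

Lemma rescale_inj : injective rescale.
Proof.
move=> v w /rowP e; apply/rowP => l; move: (e l); rewrite !mxE.
exact/mulIr/unitrX/u_unit.
Qed.

(** [u ^+ j] and [u ^+ (j %% 2)] differ by a power of [u ^+ 2], that is by a sign, which edges do
    not see. *)
Lemma rescale_gen j : exists b : bool,
  r ^+ j *: std_vec 2 n j = (-1) ^+ b *: rescale (r' ^+ j *: std_vec 2 n j).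
Proof.
have [c cE] := sign_of_pm1 u2; exists (c && odd (j %/ 2)).
apply/rowP => l; rewrite !mxE; case: eqP => [lE|_]; last by rewrite !mulr0 mul0r mulr0.
rewrite !mulr1 lE rE exprMn mulrCA; congr (_ * _).
rewrite {1}(divn_eq j 2) exprD [(j %/ 2 * 2)%N]mulnC exprM cE.
by case: c {cE} => /=; rewrite ?expr1n // expr1 signr_odd.
Qed.

Definition rescale_vertex (x : CPMbar m 2 r') : CPMbar m 2 r := (x.1, rescale x.2).

Lemma rescaleD v w : rescale (v + w) = rescale v + rescale w.
Proof. by apply/rowP => l; rewrite !mxE mulrDl. Qed.

Lemma rescaleN v : rescale (- v) = - rescale v.
Proof. by apply/rowP => l; rewrite !mxE mulNr. Qed.

Lemma rescale_arc x y : cpm_arc r (rescale_vertex x) (rescale_vertex y) = cpm_arc r' x y.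
Proof.
rewrite /cpm_arc /rescale_vertex ![(_, _).1]/= ![(_, _).2]/=; congr (_ && _).
have [b ->] := rescale_gen x.1.
by rewrite signed_eq -rescaleN -!rescaleD !(inj_eq rescale_inj).
Qed.

Lemma rescale_isomorphic : isomorphic (CPM m 2 n r') (CPM m 2 n r).
Proof.
have f_mono : {mono rescale_vertex : x y / sedge x y}.
  by move=> x y; rewrite /sedge /= /cpm_edge !rescale_arc.
have f_inj : injective rescale_vertex by move=> [i v] [k w] [-> /rescale_inj->].
have e0 : rescale_vertex (0, 0) = (0, 0).
  by congr pair; apply/rowP => l; rewrite !mxE mul0r.
have f_bij : bijective rescale_vertex by apply: inj_card_bij.
by have := isomorphic_component ((0, 0) : CPMbar m 2 r') f_bij f_mono; rewrite e0.
Qed.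

End Rescale.

Lemma none_counted (p1 p2 p3 : bool) :
  p1 = false -> p2 = false -> p3 = false -> (p1 + p2 + p3 == 0)%N = true.
Proof. by move=> -> -> ->. Qed.

Lemma one_counted (p1 p2 p3 : bool) : p1 = true -> (p1 + p2 + p3 == 0)%N = false.
Proof. by move=> ->. Qed.

Section Invariants.
Variables (m n : nat) (r : 'Z_n).
Hypothesis m_gt0 : (0 < m)%N.
Hypothesis n_ge3 : (3 <= n)%N.
Hypothesis n_neq4 : n <> 4%N.
Hypothesis ms_ge3 : (3 <= m * 2)%N.
Hypothesis r_unit : r \is a GRing.unit.
Hypothesis r_ms : r ^+ (m * 2) = 1 \/ r ^+ (m * 2) = -1.
Hypothesis Gamma_2at : two_arc_transitive (CPM m 2 n r).
Let n_gt1 : (1 < n)%N. Proof. exact: ltnW. Qed.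

Definition turn_arc (S : lifted 2 n) :=
  (cov m r S, cov m r (step r S (U false)), cov m r (step r (step r S (U false)) (D false))).

Lemma turn_arc_invariants : exists S,
  [/\ connect (@sedge (CPMbar m 2 r)) (0, 0) (turn_arc S).1.1, two_arc (turn_arc S),
   (ext_count (pred1 0%N) 4 (turn_arc S).1.1 (turn_arc S).1.2 (turn_arc S).2 == 0%N) = (n == 3%N) &
   n <> 3%N -> forall k,
     zigzag 4 k (turn_arc S).1.1 (turn_arc S).1.2 (turn_arc S).2
                (turn_arc S).1.1 (turn_arc S).1.2 (turn_arc S).2 = (2 %| k)%N && (n %| k)%N].
Proof.
have [S S_ge S_root] := root_lift r ms_ge3; exists S.
have S_gt2 : (2 < S.1)%N by apply: leq_trans S_ge.
have [b q_folded] := folded_exists m_gt0 n_ge3 n_neq4 ms_ge3 r_unit r_ms Gamma_2at.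
rewrite /turn_arc ![(_, _).1]/= ![(_, _).2]/=; split.
- by rewrite S_root connect0.
- by apply: two_arc_cov => //; apply: ltnW.
- rewrite (ext_count_cov n_ge3 ms_ge3 r_unit r_ms (pred1 0%N) 4 (U false) (D false) S_gt2).
  rewrite (sum_after_down (fun l => pred1 0%N (closed_walks m r 4 S (U false) (D false) l) : nat)).
  case: (n =P 3%N) => n3.
    have pos l : l != letter_inv (D false) -> pred1 0%N (closed_walks m r 4 S (U false) (D false) l) = false.
      move=> l_ok; apply: gtn_eqF; apply: (hex_turn_pos n_ge3 ms_ge3 r_unit r_ms q_folded) => //.
      by rewrite n3.
    exact: none_counted (pos (U false) isT) (pos (D false) isT) (pos (D true) isT).
  have [_ only] := hex_peak m_gt0 n_ge3 n_neq4 ms_ge3 r_unit r_ms Gamma_2at q_folded n3 S_ge.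
  have e : pred1 0%N (closed_walks m r 4 S (U false) (D false) (U false)) = true := only (U false) isT.
  exact: one_counted e.
- move=> n3 k; apply: zigzag_turn => // T T_ge.
    exact: (hex_peak m_gt0 n_ge3 n_neq4 ms_ge3 r_unit r_ms Gamma_2at q_folded n3).
  exact: (hex_valley m_gt0 n_ge3 n_neq4 ms_ge3 r_unit r_ms Gamma_2at q_folded n3).
Qed.

Lemma n_even_neq3 : (2 %| n)%N -> n <> 3%N.
Proof. by move=> h n3; rewrite n3 in h. Qed.

Lemma square_shape : exists b : bool,
  (-1) ^+ b * r ^+ 2 = if (2 %| n)%N then 1 + (n %/ 2)%:R else 1.
Proof.
have [b q_folded] := folded_exists m_gt0 n_ge3 n_neq4 ms_ge3 r_unit r_ms Gamma_2at.
exists b; case: ifPn => h.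
  by have [] := even_case m_gt0 n_ge3 n_neq4 ms_ge3 r_unit r_ms Gamma_2at q_folded (n_even_neq3 h) h.
exact: (odd_case n_ge3 q_folded h).
Qed.

Lemma even_dvd : (2 %| n)%N -> (4 %| n)%N /\ (2 %| m)%N.
Proof.
have [b q_folded] := folded_exists m_gt0 n_ge3 n_neq4 ms_ge3 r_unit r_ms Gamma_2at.
move=> h; by have [] := even_case m_gt0 n_ge3 n_neq4 ms_ge3 r_unit r_ms Gamma_2at q_folded (n_even_neq3 h) h.
Qed.

Lemma card_two_arc_transitive : #|CPM m 2 n r| = (m * 2 * #|doubles n|)%N.
Proof.
apply: card_CPM => //; have [h|h] := boolP (2 %| n)%N.
  by right; split=> //; have [] := even_dvd h.
by left; rewrite -[odd n]negbK -dvdn2.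
Qed.

End Invariants.

(** The hypothesis says lcm(2, n) = lcm(2, n'). The only ambiguity is an odd number against its
    double, and the double of an odd number is not divisible by 4. *)
Lemma eq_of_double_dvd n n' : (0 < n)%N -> (0 < n')%N ->
  ((2 %| n) -> (4 %| n))%N -> ((2 %| n') -> (4 %| n'))%N ->
  (forall k, ((2 %| k) && (n %| k) = (2 %| k) && (n' %| k))%N) -> n = n'.
Proof.
move=> n_gt0 n'_gt0 n4 n4' h.
have d : (n %| n' * 2)%N.
  by have := h (n' * 2)%N; rewrite (dvdn_mull n' (dvdnn 2)) (dvdn_mulr 2 (dvdnn n')).
have d' : (n' %| n * 2)%N.
  by have := h (n * 2)%N; rewrite (dvdn_mull n (dvdnn 2)) (dvdn_mulr 2 (dvdnn n)) => /esym.
have half a c : (0 < a)%N -> (0 < c)%N -> ((2 %| a) -> (4 %| a))%N ->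
    ((2 %| c) -> (4 %| c))%N ->
    (forall k, ((2 %| k) && (a %| k) = (2 %| k) && (c %| k))%N) -> (a %| c * 2)%N -> (a %| c)%N.
  move=> a_gt0 c_gt0 a4 c4 hk ac; have [c_even|c_odd] := boolP (2 %| c)%N.
    by have := hk c; rewrite c_even dvdnn /= => ->.
  have [a_even|a_odd] := boolP (2 %| a)%N; last first.
    by rewrite -(@Gauss_dvdl a c 2) // coprime_sym prime_coprime.
  exfalso; move/negP: c_odd; apply.
  have := dvdn_trans (a4 a_even) ac.
  by rewrite -[4%N]/(2 * 2)%N dvdn_pmul2r.
by apply/eqP; rewrite eqn_dvd (half n n') // (half n' n).
Qed.

Theorem proposition9p1
  (m s n : nat) (r : 'Z_n)
  (m_gt0 : (0 < m)%N) (s_ge2 : (2 <= s)%N) (n_ge3 : (3 <= n)%N) (n_neq4 : n <> 4%N)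
  (ms_ge3 : (3 <= m * s)%N) (r_unit : r \is a GRing.unit)
  (r_ms : r ^+ (m * s) = 1 \/ r ^+ (m * s) = -1)
  (m' s' n' : nat) (r' : 'Z_n')
  (m'_gt0 : (0 < m')%N) (s'_ge2 : (2 <= s')%N) (n'_ge3 : (3 <= n')%N) (n'_neq4 : n' <> 4%N)
  (m's'_ge3 : (3 <= m' * s')%N) (r'_unit : r' \is a GRing.unit)
  (r'_ms : r' ^+ (m' * s') = 1 \/ r' ^+ (m' * s') = -1)
  (Gamma_2at : two_arc_transitive (CPM m s n r))
  (Gamma'_2at : two_arc_transitive (CPM m' s' n' r')) :
  isomorphic (CPM m' s' n' r') (CPM m s n r) <->
  [/\ m' = m, s' = s /\ s = 2%N, n' = n &
      (Zn_cast n r' / r) ^+ 2 = 1 \/ (Zn_cast n r' / r) ^+ 2 = -1].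
Proof.
have s2 := s_eq2 m_gt0 n_ge3 n_neq4 ms_ge3 r_unit r_ms Gamma_2at s_ge2.
have s2' := s_eq2 m'_gt0 n'_ge3 n'_neq4 m's'_ge3 r'_unit r'_ms Gamma'_2at s'_ge2.
have n_gt1 : (1 < n)%N by apply: ltnW.
subst s s'; split=> [iso|]; last first.
  case=> m_eq _ n_eq; subst m' n'.
  have -> : Zn_cast n r' = r' by rewrite /Zn_cast -(Zn_natE r' n_gt1).
  move=> rr; apply: (@rescale_isomorphic m n r r' (r / r')).
    by rewrite mulrC divrK.
  have -> : r / r' = (r' / r)^-1 by rewrite invrM ?unitrV // invrK.
  by rewrite exprVn; case: rr => ->; [left; rewrite invr1|right; rewrite invrN1].
have [S [conn arc ext zz]] := turn_arc_invariants m_gt0 n_ge3 n_neq4 ms_ge3 r_unit r_ms Gamma_2at.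
have [S' [conn' arc' ext' zz']] :=
  turn_arc_invariants m'_gt0 n'_ge3 n'_neq4 m's'_ge3 r'_unit r'_ms Gamma'_2at.
have n3 : (n' == 3%N) = (n == 3%N).
  by rewrite -ext -ext' (isomorphic_ext_count iso Gamma_2at arc' arc conn' conn).
have e4 := even_dvd m_gt0 n_ge3 n_neq4 ms_ge3 r_unit r_ms Gamma_2at.
have e4' := even_dvd m'_gt0 n'_ge3 n'_neq4 m's'_ge3 r'_unit r'_ms Gamma'_2at.
have n_eq : n' = n.
  case: (n =P 3%N) => [n_3|n_3]; first by rewrite n_3; apply/eqP; rewrite n3 n_3.
  have n'_3 : n' <> 3%N by apply/eqP; rewrite n3; apply/eqP.
  apply: eq_of_double_dvd => [||/e4'[]|/e4[]|k] //; try exact: ltnW (ltnW _).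
  by rewrite -zz // -zz' // (isomorphic_zigzag iso Gamma_2at arc' arc conn' conn).
subst n'.
have [b bE] := square_shape m_gt0 n_ge3 n_neq4 ms_ge3 r_unit r_ms Gamma_2at.
have [b' bE'] := square_shape m'_gt0 n'_ge3 n'_neq4 m's'_ge3 r'_unit r'_ms Gamma'_2at.
split=> //.
  have [f f_bij _] := iso; have := bij_eq_card f_bij.
  rewrite (card_two_arc_transitive m_gt0 n_ge3 n_neq4 ms_ge3 r_unit r_ms Gamma_2at).
  rewrite (card_two_arc_transitive m'_gt0 n'_ge3 n'_neq4 m's'_ge3 r'_unit r'_ms Gamma'_2at).
  have d_gt0 : (0 < #|doubles n|)%N by apply/card_gt0P; exists 0; apply: doubles0.
  by move/eqP; rewrite eqn_pmul2r // eqn_pmul2r // => /eqP.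
have -> : Zn_cast n r' = r' by rewrite /Zn_cast -(Zn_natE r' n_gt1).
(* Up to sign both squares equal the same element, which depends on n alone. *)
have e : r' ^+ 2 = (-1) ^+ (b' (+) b) * r ^+ 2.
  by rewrite signr_addb -mulrA bE -bE' mulrA -signr_addb addbb mul1r.
rewrite exprMn exprVn e mulrK ?unitrX //.
by case: (b' (+) b); [right; rewrite expr1|left].
Qed.
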